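(* Let $q$ be a prime power, let $G=PGL_2(\mathbf F_q((t^{-1})))$ and $\Gamma=PGL_2(\mathbf F_q[t])$. Let $X=\{x_n : n\ge 0\}$ be the half-line carrying the random walk $\overline\mu$ with $\overline\mu(x_0,x_1)=1$, and $\overline\mu(x_n,x_{n+1})=\frac1{q+1}$, $\overline\mu(x_n,x_{n-1})=\frac{q}{q+1}$ for $n\ge 1$ (all other transition probabilities being $0$), and let $h(X)$ be its Cheeger constant. Then $$h(X)\ \ge\ \min\left\{\frac{q-1}{q+1},\ \frac{4q^2}{(q+1)(q^2-1)}\right\}\ >\ 0 .$$ Consequently, the action of $G$ on $\Gamma\backslash G$ by right translations has the Spectral Gap Property.
   Context: $\mathbf F_q$ is the finite field with $q$ elements, and $\mathbf F_q((t^{-1}))$ is the local field of formal Laurent series in $t^{-1}$ over $\mathbf F_q$ (the completion of $\mathbf F_q(t)$ at the infinite place). $\Gamma$ is a non-uniform lattice in $G$, and $\Gamma\backslash G$ is equipped with its unique $G$-invariant probability measure. The random walk $\overline\mu$ is the projection to $X=\Gamma\backslash T$ of the simple random walk on the $(q+1)$-regular tree $T=G/K$ of $G$, where $K=PGL_2(\mathbf F_q[[t^{-1}]])$; here $x_n$ is the class of $\begin{pmatrix} t^n&0\\0&1\end{pmatrix}$. A stationary (reversing) measure $\overline m$ for $\overline\mu$, that is, one with $\overline m(x)\overline\mu(x,y)=\overline m(y)\overline\mu(y,x)$, is given up to scaling by $\overline m(x_0)=\frac{1}{q(q^2-1)}$ and $\overline m(x_n)=\frac{1}{q^{n+1}(q-1)}$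 for $n\ge1$. It is finite and is normalized to be a probability measure on $X$. Cheeger constant: put $\widetilde\mu(x,y)=\overline m(x)\overline\mu(x,y)$, and for $E\subset X\times X$ let $\widetilde\mu(E)=\sum_{(x,y)\in E}\widetilde\mu(x,y)$. Then $$h(X)=\inf_{S}\frac{\widetilde\mu(S\times S^c)}{\overline m(S)\,\overline m(S^c)},$$ the infimum being over all non-empty proper subsets $S\subset X$, with $S^c=X\setminus S$. Spectral Gap Property: for a measure preserving action of a locally compact group $G$ on a probability space $(Y,m)$, let $\pi_Y$ be the associated unitary (Koopman) representation of $G$ on $L^2_0(Y)=\{f\in L^2(Y,m): \int_Y f\,dm=0\}$. The action has the Spectral Gap Property if there exist a compact set $Q\subset G$ and $\varepsilon>0$ with $\sup_{s\in Q}\|\pi_Y(s)f-f\|\ge\varepsilon\|f\|$ for all $f\in L^2_0(Y)$. *)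

(* Defs.v *)
From HB Require Import structures.
From mathcomp Require Import all_boot all_order all_algebra.
From mathcomp Require Import all_classical all_reals all_analysis.
From mathcomp Require Import complex.
From mathcomp Require Import zify.

Set Implicit Arguments.
Unset Strict Implicit.
Unset Printing Implicit Defensive.
Import Order.TTheory GRing.Theory Num.Theory.

Local Open Scope classical_set_scope.
Local Open Scope ring_scope.

(* A Laurent series in t^-1 is the family of its coefficients; the coefficient
   of index n is that of t^(-n), so only finitely many indices n < 0 occur. *)

Definition laurent_pred (F : fieldType) : pred (int -> F) :=
  fun f => `[< exists N : int, forall n, n < N -> f n = 0 >].

Record laurent (F : fieldType) := Laurent {
  lcoef :> int -> F;
  lcoefP : lcoef \in @laurent_pred F }.

HB.instance Definition _ (F : fieldType) := [isSub for @lcoef F].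
HB.instance Definition _ (F : fieldType) := [Choice of laurent F by <:].

Section LaurentRing.
Variable F : fieldType.
Implicit Types (f g h : laurent F) (n a b : int).

Let shift_ex (a n : int) : a <= n -> exists k : nat, n = a + k%:Z.
Proof. by move=> an; exists `|(n - a)%R|%N; lia. Qed.

Lemma laurent_ext f g : (forall n, f n = g n) -> f = g.
Proof. by move=> fg; apply/val_inj/funext. Qed.

Lemma laurent_zmod_closed : zmod_closed (@laurent_pred F).
Proof.
split; first by apply/asboolP; exists 0.
move=> f g /asboolP[M fM] /asboolP[N gN]; apply/asboolP.
exists (Num.min M N) => n; rewrite lt_min => /andP[nM nN].
by rewrite /GRing.add /GRing.opp /= fM // gN // subr0.
Qed.

HB.instance Definition _ :=
  GRing.isZmodClosed.Build (int -> F) (@laurent_pred F) laurent_zmod_closed.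
HB.instance Definition _ := [SubChoice_isSubZmodule of laurent F by <:].

Lemma lcoefD f g n : (f + g) n = f n + g n. Proof. by []. Qed.
Lemma lcoef0 n : (0 : laurent F) n = 0. Proof. by []. Qed.

Definition below f a := forall n, n < a -> f n = 0.

Lemma below_ex f : exists a, below f a.
Proof. by case: f => f /= fP; apply/asboolP. Qed.

Lemma below_le f a b : b <= a -> below f a -> below f b.
Proof. by move=> ba fa n nb; apply: fa; exact: lt_le_trans ba. Qed.

Definition lconv (f g : int -> F) : int -> F :=
  fun n => \sum_(i \in [set: int]) f i * g (n - i).

Lemma lconv_window (f g : laurent F) a b k : below f a -> below g b ->
  lconv f g (a + b + k%:Z) = \sum_(i < k.+1) f (a + i%:Z) * g (b + (k - i)%N%:Z).
Proof.
move=> fa gb; rewrite /lconv (fsbigE [seq a + i%:Z | i <- iota 0 k.+1]) //.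
- rewrite big_map -[iota _ _]/(index_iota 0 k.+1) big_mkord /=.
  apply: eq_big => [i|i _]; first by rewrite in_setT.
  by congr (_ * g _); have := ltn_ord i; lia.
- by rewrite map_inj_uniq ?iota_uniq // => i j; lia.
move=> i _ iN; have [ia|ai] := ltP i a; first by rewrite fa // mul0r.
rewrite [g _]gb ?mulr0 //; rewrite ltNge; apply: contra iN => ki.
have [j ij] := shift_ex ai; apply/mapP; exists j => //.
by rewrite mem_iota; lia.
Qed.

Lemma lconv_below (f g : laurent F) a b n : below f a -> below g b ->
  n < a + b -> lconv f g n = 0.
Proof.
move=> fa gb nab; rewrite /lconv fsbig1 // => i _.
have [ia|ai] := ltP i a; first by rewrite fa // mul0r.
by rewrite [g _]gb ?mulr0 //; lia.
Qed.

Lemma lconv_laurent f g : lconv f g \in @laurent_pred F.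
Proof.
have [[a fa] [b gb]] := (below_ex f, below_ex g).
by apply/asboolP; exists (a + b) => n; exact: lconv_below.
Qed.

Definition lmul f g : laurent F := Laurent (lconv_laurent f g).

Lemma single_laurent a (c : F) :
  (fun n : int => if n == a then c else 0) \in @laurent_pred F.
Proof. by apply/asboolP; exists a => n /lt_eqF ->. Qed.

(* the monomial c * t^(-a) *)
Definition lmonom a (c : F) : laurent F := Laurent (single_laurent a c).

Lemma lmul_monom a c f n : lmul (lmonom a c) f n = c * f (n - a).
Proof.
rewrite /= /lconv -(@fsbig_widen _ _ _ _ [set a]) //.
  by rewrite fsbig_set1 eqxx.
by move=> i [_ /= /eqP/negPf ia]; rewrite ia mul0r.
Qed.

Let tr f a N : {poly F} := \poly_(i < N) f (a + i%:Z).

Lemma lmul_tr f g a b N k : below f a -> below g b -> (k < N)%N ->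
  lmul f g (a + b + k%:Z) = (tr f a N * tr g b N)`_k.
Proof.
move=> fa gb kN; rewrite /= lconv_window // coefM.
apply: eq_bigr => i _; rewrite !coef_poly !ifT //.
  by apply: leq_ltn_trans kN; exact: leq_subr.
by apply: leq_ltn_trans kN; rewrite -ltnS.
Qed.

Lemma below_mul f g a b : below f a -> below g b -> below (lmul f g) (a + b).
Proof. by move=> fa gb n; exact: lconv_below. Qed.

Lemma lmulC : commutative lmul.
Proof.
move=> f g; have [[a fa] [b gb]] := (below_ex f, below_ex g).
apply: laurent_ext => n; have [nab|abn] := ltP n (a + b).
  by rewrite (below_mul fa gb) // (below_mul gb fa) // addrC.
have [k ->] := shift_ex abn.
by rewrite (lmul_tr fa gb (ltnSn _)) mulrC [a + b]addrC (lmul_tr gb fa (ltnSn _)).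
Qed.

Lemma trM f g a b N : below f a -> below g b ->
  tr (lmul f g) (a + b) N = take_poly N (tr f a N * tr g b N).
Proof.
move=> fa gb; apply/polyP => k; rewrite coef_poly coef_take_poly.
by case: ifP => // kN; rewrite (lmul_tr fa gb kN).
Qed.

Lemma coefM_take (p r : {poly F}) N k : (k < N)%N ->
  (p * take_poly N r)`_k = (p * r)`_k.
Proof.
move=> kN; rewrite !coefM; apply: eq_bigr => i _; rewrite coef_take_poly ifT //.
by apply: leq_ltn_trans kN; exact: leq_subr.
Qed.

Lemma lmulA : associative lmul.
Proof.
move=> f g h.
have [[a fa] [b gb] [c hc]] := And3 (below_ex f) (below_ex g) (below_ex h).
have fg := below_mul fa gb; have gh := below_mul gb hc.
apply: laurent_ext => n; have [ns|sn] := ltP n (a + b + c).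
  by rewrite (below_mul fg hc) // (below_mul fa gh) // addrA.
have [k ->] := shift_ex sn.
rewrite (lmul_tr fg hc (ltnSn _)) -[a + b + c]addrA (lmul_tr fa gh (ltnSn _)).
rewrite !trM // coefM_take // [in RHS]mulrC coefM_take //.
by rewrite mulrA [in RHS]mulrC.
Qed.

Lemma lmul1 : left_id (lmonom 0 1) lmul.
Proof. by move=> f; apply: laurent_ext => n; rewrite lmul_monom mul1r subr0. Qed.

Lemma lmulDl : left_distributive lmul +%R.
Proof.
move=> f g h.
have [[a fa] [b gb] [c hc]] := And3 (below_ex f) (below_ex g) (below_ex h).
have {}fa : below f (Num.min a b) by apply: below_le fa; rewrite ge_min lexx.
have {}gb : below g (Num.min a b).
  by apply: below_le gb; rewrite ge_min lexx orbT.
move: {a b}(Num.min a b) fa gb => a fa ga.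
have fga : below (f + g) a by move=> n na; rewrite lcoefD fa // ga // addr0.
apply: laurent_ext => n; rewrite lcoefD; have [nab|abn] := ltP n (a + c).
  by rewrite (below_mul fa hc) // (below_mul ga hc) // (below_mul fga hc) ?addr0.
have [k ->] := shift_ex abn.
rewrite (lmul_tr fa hc (ltnSn _)) (lmul_tr ga hc (ltnSn _)).
rewrite (lmul_tr fga hc (ltnSn _)) -coefD -mulrDl.
suff -> : tr (f + g) a k.+1 = tr f a k.+1 + tr g a k.+1 by [].
by apply/polyP => j; rewrite coefD !coef_poly lcoefD; case: ifP; rewrite ?addr0.
Qed.

Lemma lone_neq0 : lmonom 0 1 != 0.
Proof.
apply/eqP => /(congr1 (fun f : laurent F => f 0)) /eqP.
by rewrite /= oner_eq0.
Qed.

HB.instance Definition _ := GRing.Zmodule_isComNzRing.Build (laurent F)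
  lmulA lmulC lmul1 lmulDl lone_neq0.

Lemma lcoefM f g n : (f * g) n = \sum_(i \in [set: int]) f i * g (n - i).
Proof. by []. Qed.

Lemma lcoef1 n : (1 : laurent F) n = (n == 0)%:R.
Proof. by rewrite /=; case: eqP. Qed.

Lemma lval_ex f : f != 0 -> exists2 v, f v != 0 & below f v.
Proof.
move=> f0; have [a fa] := below_ex f.
have [k fk] : exists k, f (a + k%:Z) != 0.
  apply: contrapT => /forallNP fk; case/eqP: f0; apply: laurent_ext => n.
  have [/fa //|/shift_ex[k ->]] := ltP n a.
  by apply/eqP; have /negP := fk k; rewrite negbK.
have ex : exists k, f (a + k%:Z) != 0 by exists k.
case: (ex_minnP ex) => m fm mmin; exists (a + m%:Z) => // n nam.
have [/fa //|/shift_ex[j nj]] := ltP n a.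
apply/eqP; apply: contraTT nam => fn; rewrite -leNgt.
by have := mmin j; rewrite -nj => /(_ fn); lia.
Qed.

Section Inverse.
Variable p : nat -> F.

Fixpoint pinvs (k : nat) : seq F :=
  if k is k'.+1 then
    rcons (pinvs k')
      (((k' == 0)%:R - \sum_(j < k') (pinvs k')`_j * p (k' - j)%N) / p 0)
  else [::].

Definition pinv k := (pinvs k.+1)`_k.

Lemma size_pinvs k : size (pinvs k) = k.
Proof. by elim: k => //= k IHk; rewrite size_rcons IHk. Qed.

Lemma nth_pinvs k j : (j < k)%N -> (pinvs k)`_j = pinv j.
Proof.
elim: k => // k IHk; rewrite ltnS leq_eqVlt => /predU1P[->//|jk].
by rewrite /= nth_rcons size_pinvs jk IHk.
Qed.

Lemma pinvP k : p 0 != 0 ->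
  \sum_(j < k.+1) pinv j * p (k - j)%N = (k == 0)%:R.
Proof.
move=> p0; rewrite big_ord_recr /= subnn.
rewrite [pinv k]/pinv /= nth_rcons size_pinvs ltnn eqxx divfK //.
under [X in _ - X]eq_bigr => j _ do rewrite nth_pinvs //.
by rewrite addrC subrK.
Qed.
End Inverse.

Lemma linv_ex f : exists g, f != 0 -> g * f = 1.
Proof.
have [->|f0] := eqVneq f 0; first by exists 0.
have [v fv vf] := lval_ex f0.
pose p k := f (v + k%:Z).
have p0 : p 0%N != 0 by rewrite /p addr0.
have gP : (fun n => if - v <= n then pinv p `|(n + v)%R|%N else 0)
            \in @laurent_pred F.
  by apply/asboolP; exists (- v) => n nv; rewrite leNgt nv.
exists (Laurent gP) => _; set g := Laurent gP.
have gv : below g (- v) by move=> n nv; rewrite /= leNgt nv.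
apply: laurent_ext => n; rewrite lcoef1; have [n0|n0] := ltP n 0.
  by rewrite [LHS](below_mul gv vf) ?addNr //; case: eqP => // n0'; lia.
have [k ->] := shift_ex n0; rewrite add0r.
have -> : (k%:Z == 0) = (k == 0%N) by [].
rewrite -(pinvP k p0) -[k%:Z in LHS]add0r -(addNr v).
rewrite [LHS](lconv_window k gv vf).
apply: eq_bigr => i _; rewrite /g /= ifT ?lerDl //.
by congr (pinv p _ * _); lia.
Qed.

Definition linv f : laurent F :=
  if f == 0 then 0 else projT1 (cid (linv_ex f)).

Lemma lmulV f : f != 0 -> linv f * f = 1.
Proof. by move=> f0; rewrite /linv ifN //; case: cid => /= g; apply. Qed.

Lemma linv0 : linv 0 = 0. Proof. by rewrite /linv ifT. Qed.

HB.instance Definition _ :=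
  GRing.ComNzRing_isField.Build (laurent F) lmulV linv0.

Definition laurentC (c : F) : laurent F := lmonom 0 c.

Lemma laurentC_zmod_morphism : zmod_morphism laurentC.
Proof.
move=> c d; apply: laurent_ext => n; rewrite lcoefD /= /GRing.opp /=.
by case: eqP => // _; rewrite subr0.
Qed.

Lemma laurentC_monoid_morphism : monoid_morphism laurentC.
Proof.
split=> // c d; apply: laurent_ext => n.
rewrite [RHS]lmul_monom subr0 /=.
by case: eqP; rewrite ?mulr0.
Qed.

HB.instance Definition _ :=
  GRing.isZmodMorphism.Build F (laurent F) laurentC laurentC_zmod_morphism.
HB.instance Definition _ :=
  GRing.isMonoidMorphism.Build F (laurent F) laurentC laurentC_monoid_morphism.

Definition laurent_t : laurent F := lmonom (-1) 1.

(* the inclusion of F[t] in F((t^-1)) *)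
Definition laurent_of_poly (p : {poly F}) : laurent F :=
  (map_poly laurentC p).[laurent_t].

HB.instance Definition _ := GRing.RMorphism.copy laurent_of_poly
  (horner_eval laurent_t \o map_poly laurentC).

(* basic neighbourhoods: the balls f + t^(-N) F[[t^-1]] *)
Definition laurent_nbhs f : set_system (laurent F) :=
  [set U | exists N : int, forall g, (forall n, n < N -> g n = f n) -> U g].

HB.instance Definition _ := hasNbhs.Build (laurent F) laurent_nbhs.

Lemma laurent_nbhs_filter f : ProperFilter (nbhs f).
Proof.
split; first by case=> N /(_ f); apply.
split; first by exists 0.
- move=> U V [M UM] [N VN]; exists (Num.max M N) => g gf.
  by split; [apply: UM|apply: VN] => n nM; apply: gf; rewrite lt_max nM ?orbT.
- by move=> U V UV [N UN]; exists N => g /UN /UV.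
Qed.

Lemma laurent_nbhs_singleton f (U : set (laurent F)) : nbhs f U -> U f.
Proof. by case=> N; apply. Qed.

Lemma laurent_nbhs_nbhs f (U : set (laurent F)) :
  nbhs f U -> nbhs f (nbhs^~ U).
Proof.
case=> N UN; exists N => g gf; exists N => h hg.
by apply: UN => n nN; rewrite hg // gf.
Qed.

HB.instance Definition _ := Nbhs_isNbhsTopological.Build (laurent F)
  laurent_nbhs_filter laurent_nbhs_singleton laurent_nbhs_nbhs.

End LaurentRing.

Section PGL2.
Variable F : finFieldType.
Local Notation K := (laurent F).

Record GL2 := MkGL2 { GL2_mx :> 'M[K]_2; GL2P : GL2_mx \in unitmx }.

HB.instance Definition _ := [isSub for GL2_mx].
HB.instance Definition _ := [Choice of GL2 by <:].
HB.instance Definition _ :=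
  Topological.copy GL2 (initial_topology GL2_mx).

Lemma GL2_mul_unit (A B : GL2) : GL2_mx A *m GL2_mx B \in unitmx.
Proof. by rewrite unitmx_mul (GL2P A) (GL2P B). Qed.
Lemma GL2_inv_unit (A : GL2) : invmx (GL2_mx A) \in unitmx.
Proof. by rewrite unitmx_inv (GL2P A). Qed.

Definition GL2_mul (A B : GL2) : GL2 := MkGL2 (GL2_mul_unit A B).
Definition GL2_one : GL2 := MkGL2 (unitmx1 K 2).
Definition GL2_inv (A : GL2) : GL2 := MkGL2 (GL2_inv_unit A).

Lemma GL2_mulA : associative GL2_mul.
Proof. by move=> A B C; apply: val_inj; exact: mulmxA. Qed.
Lemma GL2_mul1 : left_id GL2_one GL2_mul.
Proof. by move=> A; apply: val_inj; exact: mul1mx. Qed.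
Lemma GL2_1mul : right_id GL2_one GL2_mul.
Proof. by move=> A; apply: val_inj; exact: mulmx1. Qed.
Lemma GL2_mulV : left_inverse GL2_one GL2_inv GL2_mul.
Proof. by move=> A; apply: val_inj; exact: mulVmx (GL2P A). Qed.
Lemma GL2_Vmul : right_inverse GL2_one GL2_inv GL2_mul.
Proof. by move=> A; apply: val_inj; exact: mulmxV (GL2P A). Qed.

HB.instance Definition _ := isGroup.Build GL2
  GL2_mulA GL2_mul1 GL2_1mul GL2_mulV GL2_Vmul.

(* PGL_2 is the quotient of GL_2 by the scalar matrices, with the quotient
   topology. *)
Definition proj_eq (A B : GL2) : bool :=
  `[< exists2 c : K, c != 0 & GL2_mx A = c *: GL2_mx B >].

Lemma proj_eq_refl : reflexive proj_eq.
Proof. by move=> A; apply/asboolP; exists 1; rewrite ?oner_eq0 ?scale1r. Qed.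

Lemma proj_eq_symW A B : proj_eq A B -> proj_eq B A.
Proof.
move=> /asboolP[c c0 AB]; apply/asboolP; exists c^-1; rewrite ?invr_eq0 //.
by rewrite AB scalerA mulVf // scale1r.
Qed.

Lemma proj_eq_sym : symmetric proj_eq.
Proof. by move=> A B; apply/idP/idP; exact: proj_eq_symW. Qed.

Lemma proj_eq_trans : transitive proj_eq.
Proof.
move=> B A C /asboolP[c c0 AB] /asboolP[d d0 BC]; apply/asboolP.
by exists (c * d); rewrite ?mulf_neq0 // AB BC scalerA.
Qed.

Canonical proj_eq_equiv :=
  EquivRel proj_eq proj_eq_refl proj_eq_sym proj_eq_trans.

Definition PGL2 : Type := quotient_topology {eq_quot proj_eq}%qT.

HB.instance Definition _ := Quotient.on PGL2.
HB.instance Definition _ := Topological.on PGL2.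

Definition PGL2_class (A : GL2) : PGL2 := (\pi_PGL2 A)%qT.

Lemma PGL2_classP A B : PGL2_class A = PGL2_class B <->
  exists2 c : K, c != 0 & GL2_mx A = c *: GL2_mx B.
Proof. by split=> [/eqmodP/asboolP|?]; last exact/eqmodP/asboolP. Qed.

Lemma PGL2_reprK (x : PGL2) : PGL2_class (repr x) = x.
Proof. exact: reprK. Qed.

Definition PGL2_mul (x y : PGL2) := PGL2_class (repr x * repr y)%g.
Definition PGL2_one := PGL2_class 1%g.
Definition PGL2_inv (x : PGL2) := PGL2_class (repr x)^-1%g.

Lemma PGL2_class_mul A B :
  PGL2_mul (PGL2_class A) (PGL2_class B) = PGL2_class (A * B)%g.
Proof.
have /PGL2_classP[a a0 Aa] := PGL2_reprK (PGL2_class A).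
have /PGL2_classP[b b0 Bb] := PGL2_reprK (PGL2_class B).
apply/PGL2_classP; exists (a * b); first exact: mulf_neq0.
by rewrite /= Aa Bb -scalemxAl -scalemxAr scalerA.
Qed.

Lemma PGL2_class_inv A : PGL2_inv (PGL2_class A) = PGL2_class A^-1%g.
Proof.
have /PGL2_classP[a a0 Aa] := PGL2_reprK (PGL2_class A).
apply/PGL2_classP; exists a^-1; first by rewrite invr_eq0.
by rewrite /= Aa invmxZ // unitmxZ ?unitfE //; exact: GL2P A.
Qed.

Lemma PGL2_ind (P : PGL2 -> Prop) : (forall A, P (PGL2_class A)) -> forall x, P x.
Proof. by move=> PA x; rewrite -(PGL2_reprK x). Qed.

Lemma PGL2_mulA : associative PGL2_mul.
Proof.
elim/PGL2_ind => A; elim/PGL2_ind => B; elim/PGL2_ind => C.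
by rewrite !PGL2_class_mul mulgA.
Qed.
Lemma PGL2_mul1 : left_id PGL2_one PGL2_mul.
Proof. by elim/PGL2_ind => A; rewrite PGL2_class_mul mul1g. Qed.
Lemma PGL2_1mul : right_id PGL2_one PGL2_mul.
Proof. by elim/PGL2_ind => A; rewrite PGL2_class_mul mulg1. Qed.
Lemma PGL2_mulV : left_inverse PGL2_one PGL2_inv PGL2_mul.
Proof.
by elim/PGL2_ind => A; rewrite PGL2_class_inv PGL2_class_mul mulVg.
Qed.
Lemma PGL2_Vmul : right_inverse PGL2_one PGL2_inv PGL2_mul.
Proof.
by elim/PGL2_ind => A; rewrite PGL2_class_inv PGL2_class_mul mulgV.
Qed.

HB.instance Definition _ := isGroup.Build PGL2
  PGL2_mulA PGL2_mul1 PGL2_1mul PGL2_mulV PGL2_Vmul.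

(* PGL_2(F[t]) = GL_2(F[t]) / F^* as a subgroup of PGL_2(F((t^-1))) *)
Definition PGL2_poly : set PGL2 :=
  [set x | exists (P : 'M[{poly F}]_2) (A : GL2),
     [/\ P \in unitmx, GL2_mx A = map_mx (@laurent_of_poly F) P & x = PGL2_class A]].

Lemma PGL2_poly1 : PGL2_poly 1%g.
Proof. by exists 1%:M, 1%g; split; rewrite ?unitmx1 // map_mx1. Qed.

Lemma PGL2_polyM x y : PGL2_poly x -> PGL2_poly y -> PGL2_poly (x * y)%g.
Proof.
move=> [P [A [Pu AP ->]]] [Q [B [Qu BQ ->]]]; exists (P *m Q), (A * B)%g.
split; first by rewrite unitmx_mul Pu.
  by rewrite map_mxM -AP -BQ.
by rewrite -PGL2_class_mul.
Qed.

Lemma PGL2_polyV x : PGL2_poly x -> PGL2_poly x^-1%g.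
Proof.
move=> [P [A [Pu AP ->]]]; exists (invmx P), A^-1%g.
split; first by rewrite unitmx_inv.
  have e : map_mx (@laurent_of_poly F) (invmx P) *m GL2_mx A = 1%:M.
    by rewrite AP -map_mxM mulVmx // map_mx1.
  by rewrite [LHS]/= -[LHS]mul1mx -e -mulmxA mulmxV ?mulmx1 //; exact: GL2P A.
by rewrite -PGL2_class_inv.
Qed.

Definition lcoset_eq (x y : PGL2) : bool := `[< PGL2_poly (x * y^-1)%g >].

Lemma lcoset_eq_refl : reflexive lcoset_eq.
Proof. by move=> x; apply/asboolP; rewrite mulgV; exact: PGL2_poly1. Qed.

Lemma lcoset_eq_symW x y : lcoset_eq x y -> lcoset_eq y x.
Proof.
by move=> /asboolP/PGL2_polyV; rewrite invgM invgK => ?; exact/asboolP.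
Qed.

Lemma lcoset_eq_sym : symmetric lcoset_eq.
Proof. by move=> x y; apply/idP/idP; exact: lcoset_eq_symW. Qed.

Lemma lcoset_eq_trans : transitive lcoset_eq.
Proof.
move=> y x z /asboolP xy /asboolP yz; apply/asboolP.
by have := PGL2_polyM xy yz; rewrite mulgA mulgVK.
Qed.

Canonical lcoset_eq_equiv :=
  EquivRel lcoset_eq lcoset_eq_refl lcoset_eq_sym lcoset_eq_trans.

(* Gamma \ G: the classes of x ~ y <-> x y^-1 \in Gamma, i.e. the cosets
   Gamma x *)
Definition PGL2_quot : Type := quotient_topology {eq_quot lcoset_eq}%qT.

HB.instance Definition _ := Quotient.on PGL2_quot.
HB.instance Definition _ := Topological.on PGL2_quot.

Definition PGL2_coset (x : PGL2) : PGL2_quot := (\pi_PGL2_quot x)%qT.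

HB.instance Definition _ := isPointed.Build PGL2_quot (PGL2_coset 1%g).

Lemma PGL2_cosetP x y : PGL2_coset x = PGL2_coset y <-> PGL2_poly (x * y^-1)%g.
Proof. by split=> [/eqmodP/asboolP|?]; last exact/eqmodP/asboolP. Qed.

(* (Gamma x) . g = Gamma x g, see PGL2_actE *)
Definition PGL2_act (y : PGL2_quot) (g : PGL2) : PGL2_quot :=
  PGL2_coset (repr y * g)%g.

Lemma PGL2_actE x g : PGL2_act (PGL2_coset x) g = PGL2_coset (x * g)%g.
Proof.
have /PGL2_cosetP rx : PGL2_coset (repr (PGL2_coset x)) = PGL2_coset x.
  exact: reprK.
by apply/PGL2_cosetP; rewrite invgM !mulgA mulgK.
Qed.

Definition PGL2_borel := g_sigma_algebraType (@open PGL2_quot).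

End PGL2.

Section SpectralGap.
Context {R : realType} {d : measure_display} {Y : measurableType d}.
Context {G : topologicalType}.
Variables (m : probability Y R) (act : Y -> G -> Y).
Implicit Types f : Y -> R[i].

Definition measure_preserving :=
  forall (g : G) (A : set Y), measurable A -> m (act^~ g @^-1` A) = m A.

(* the square of the norm of L^2(Y, m), complex-valued *)
Definition sqnorm2 f : \bar R :=
  (\int[m]_y ((complex.Re (f y)) ^+ 2 + (complex.Im (f y)) ^+ 2)%:E)%E.

Definition norm2 f : R := Num.sqrt (fine (sqnorm2 f)).

(* representatives of the classes of L^2_0(Y, m) *)
Definition L20 : set (Y -> R[i]) := [set f |
  [/\ measurable_fun setT (fun y => complex.Re (f y)),
      measurable_fun setT (fun y => complex.Im (f y)),
      (sqnorm2 f < +oo)%E,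
      (\int[m]_y (complex.Re (f y))%:E = 0)%E
    & (\int[m]_y (complex.Im (f y))%:E = 0)%E]].

Definition koopman (g : G) f : Y -> R[i] := fun y => f (act y g).

Definition spectral_gap : Prop :=
  exists (Q : set G) (eps : R), [/\ compact Q, 0 < eps &
    forall f, L20 f ->
      ((eps * norm2 f)%:E <=
         ereal_sup [set (norm2 (fun y => koopman s f y - f y))%:E | s in Q])%E].

End SpectralGap.

Section Cheeger.
Context {R : realType} {X : choiceType}.
Variables (mu : X -> X -> R) (m : X -> R).

Definition mass (S : set X) : R := fine (\esum_(x in S) (m x)%:E).

Definition flow (E : set (X * X)) : R :=
  fine (\esum_(e in E) (m e.1 * mu e.1 e.2)%:E).

(* mass and flow are genuine sums as soon as m is summable and mu is a
   Markov kernel; fine only projects \bar R to R. *)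
Definition cheeger : R :=
  inf [set flow (S `*` ~` S) / (mass S * mass (~` S)) |
       S in [set S | S !=set0 /\ S != setT]].

End Cheeger.

Section RandomWalk.
Context (R : realType) (q : nat).

(* the state x_n of the half-line is encoded by n *)
Definition walk (n k : nat) : R :=
  if n == 0%N then (k == 1%N)%:R
  else if k == n.+1 then 1 / (q%:R + 1)
  else if k == n.-1 then q%:R / (q%:R + 1)
  else 0.

Definition walk_weight (n : nat) : R :=
  if n == 0%N then 1 / (q%:R * (q%:R ^+ 2 - 1))
  else 1 / (q%:R ^+ n.+1 * (q%:R - 1)).

(* the reversing probability measure of the walk *)
Definition walk_measure (n : nat) : R :=
  walk_weight n / fine (\esum_(k in [set: nat]) (walk_weight k)%:E).

End RandomWalk.

(* Main.v *)
Require Import Defs.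
From HB Require Import structures.
From mathcomp Require Import all_boot all_order all_algebra.
From mathcomp Require Import all_classical all_reals all_analysis.
From mathcomp Require Import measurable_realfun complex zify ring lra.

Set Implicit Arguments.
Unset Strict Implicit.
Unset Printing Implicit Defensive.
Import Order.TTheory GRing.Theory Num.Theory.
Import numFieldNormedType.Exports.

Local Open Scope classical_set_scope.
Local Open Scope ring_scope.

(** The Cheeger bound.  A proper non-empty subset S of the half-line or its
    complement misses x_0; let x_n, with n >= 1, be the smallest point of the
    one that does.  The weights decay geometrically, so x_n carries at least
    the fraction (q-1)/q of the mass of that set, and a fraction q/(q+1) of the
    mass of x_n flows to x_(n-1), outside of the set.  The walk is reversible,
    so it does not matter which of S and its complement contains x_n, and the
    ratio is at least (q-1)/(q+1) [cheeger_walk_ge].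

    The spectral gap.  The argument transposes this picture from the half-line
    to Gamma\G itself.  The map G -> Gamma\G/K -> {x_n} gives every point y of
    Gamma\G a level [lev y], locally constant because it is invariant under the
    congruence subgroup K_1 of the matrices congruent to 1 modulo 1/t.  Three
    conjugates s_0, s_1, s_2 of diag(t, 1) by constant matrices are chosen so
    that, from any point of positive level, at least two of the s_i, and at
    least two of their inverses, lead to a lower level [steps_down]: a step
    fails to go down only if a non-zero vector of F^2 attached to the point is
    orthogonal to a vector attached to the step, and the three vectors are
    pairwise independent.

    Let u be in L^2 with |u.s_i - u|^2 <= D in square mean, let a1 and a0 be the
    integrals of u^2 over the points of positive level and of level 0.
    Comparing u(y) with u(y s_i) for the steps that go down, and moving back by
    the invariance of the measure, gives 2 a1 <= 3/2 (a1 + 3 a0) + 9 D, because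
    a point of positive level is the end of at most one step that goes down,
    and a point of level 0 of at most three [cusp_level].  As 3/2 < 2, a1 is controlled by a0 and D.

    The points of level 0 form a single orbit of K_1 [lev0].  A function
    invariant under a smaller congruence subgroup K_j becomes constant on this
    orbit when it is averaged over the finite set K_1/K_j [congr_average], and
    averaging moves it little if K_1 does.  These functions are dense in L^2
    [approx_loc_const], as every open set is the increasing union of the sets
    of the points whose K_j-orbit it contains.  Hence a function f that K_1
    moves little is close on level 0 to a constant c [base_level]; then the
    previous paragraph applies to u = f - c, and subtracting a constant from a
    function of mean zero does not decrease its norm [real_gap].  So the
    compact set that is the union of K_1 and {s_0, s_1, s_2} witnesses the
    spectral gap. *)

(** * The Cheeger constant of the half-line *)

Section Cheeger.
Context {R : realType}.

Lemma esum_sub (T : choiceType) (A B : set T) (a : T -> \bar R) :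
  A `<=` B -> (\esum_(i in A) a i <= \esum_(i in B) a i)%E.
Proof.
move=> AB; apply: ge_ereal_sup => _ [X [finX XA] <-].
by apply: esum_ge; exists X => //; split => // y /XA /AB.
Qed.

Lemma esum_nat_ub (S : set nat) (a : nat -> R) (C : R) :
  (forall i, 0 <= a i) -> (forall N, \sum_(0 <= i < N) a i <= C) ->
  (\esum_(i in S) (a i)%:E <= C%:E)%E.
Proof.
move=> a0 aC; apply: le_trans (esum_sub _ (@subsetT _ S)) _.
rewrite -nneseries_esumT; last by move=> i; rewrite lee_fin.
apply: lime_le; first by apply: is_cvg_nneseries => i _ _; rewrite lee_fin.
by near=> N; rewrite sumEFin lee_fin.
Unshelve. all: end_near. Qed.

Lemma esum_pos_fin (T : choiceType) (S : set T) (a : T -> \bar R) :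
  (forall i, 0 <= a i)%E -> (\esum_(i in S) a i < +oo)%E ->
  \esum_(i in S) a i \is a fin_num.
Proof. by move=> a0 aoo; rewrite ge0_fin_numE// esum_ge0. Qed.

Lemma esum_ge_term (T : choiceType) (S : set T) (a : T -> \bar R) x :
  S x -> (a x <= \esum_(i in S) a i)%E.
Proof.
move=> Sx; apply: esum_ge; exists [set x]; last by rewrite fsbig_set1.
by split => // y ->.
Qed.

Variable q : nat.
Hypothesis qge2 : 2 <= q%:R :> R.

Lemma walk_weight_gt0 n : 0 < walk_weight R q n.
Proof.
have h2 := qge2.
rewrite /walk_weight; case: ifP => _; rewrite divr_gt0 // mulr_gt0 ?exprn_gt0//.
- lra.
- by rewrite subr_gt0 expr_gt1//; lra.
- lra.
- by rewrite subr_gt0; lra.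
Qed.

Lemma walk_weightS n : walk_weight R q n.+2 = walk_weight R q n.+1 / q%:R.
Proof.
have h2 := qge2.
have x0 : q%:R ^+ n != 0 :> R by rewrite expf_neq0//; apply: lt0r_neq0; lra.
rewrite /walk_weight /= !exprS; field; rewrite x0 /=.
by do ?[apply/andP; split] => //; apply: lt0r_neq0; lra.
Qed.

Lemma walk_weight1 :
  walk_weight R q 0 = walk_weight R q 1 * (q%:R / (q%:R + 1)).
Proof.
have h2 := qge2.
rewrite /walk_weight /=; field.
by do ?[apply/andP; split] => //; apply: lt0r_neq0; nra.
Qed.

Lemma sum_tail_le (m : nat -> R) (S : set nat) n N :
    (forall i, 0 <= m i) -> (forall i, m i.+2 = m i.+1 / q%:R) ->
    (0 < n)%N -> (forall i, S i -> (n <= i)%N) ->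
  \sum_(0 <= i < N) (if i \in S then m i else 0) <= q%:R / (q%:R - 1) * m n.
Proof.
have h2 := qge2.
move=> m0 mS n0 nS.
(* T i - T i.+1 is m i from n on, as m decays by the factor q, and 0 before:
   the sum telescopes *)
pose T i := q%:R / (q%:R - 1) * m (maxn i n).
have T0 i : 0 <= T i.
  by apply: mulr_ge0 => //; apply: divr_ge0; lra.
have le_T i : (if i \in S then m i else 0) <= - T i.+1 - (- T i).
  rewrite /T; case: ifPn => [/set_mem/nS ni|_].
    have -> : maxn i n = i by lia.
    have -> : maxn i.+1 n = i.+1 by lia.
    case: i ni => [|i] ni; first lia.
    rewrite mS -subr_ge0 le_eqVlt; apply/orP; left; apply/eqP; field.
    by do ?[apply/andP; split] => //; apply: lt0r_neq0; lra.
  have [ni|ni] := leqP n i; last first.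
    have -> : maxn i.+1 n = n by lia.
    by rewrite subrr.
  have -> : maxn i.+1 n = i.+1 by lia.
  case: i ni => [|i] ni; first lia.
  rewrite mS; have -> : - (q%:R / (q%:R - 1) * (m i.+1 / q%:R))
     - (- (q%:R / (q%:R - 1) * m i.+1)) = m i.+1 :> R; last exact: m0.
  by field; do ?[apply/andP; split] => //; apply: lt0r_neq0; lra.
apply: le_trans (ler_sum_nat (fun i _ => le_T i)) _.
rewrite (telescope_sumr (fun i => - T i))//.
have -> : q%:R / (q%:R - 1) * m n = T 0%N by rewrite /T max0n.
by have := T0 N; lra.
Qed.

Let W := fine (\esum_(k in [set: nat]) (walk_weight R q k)%:E).

Let esumW_fin : \esum_(k in [set: nat]) (walk_weight R q k)%:E \is a fin_num.
Proof.
have h2 := qge2.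
apply: esum_pos_fin => [i|]; first by rewrite lee_fin ltW// walk_weight_gt0.
apply: (@le_lt_trans _ _
  (walk_weight R q 0 + q%:R / (q%:R - 1) * walk_weight R q 1)%:E).
  apply: esum_nat_ub => [i|N]; first exact/ltW/walk_weight_gt0.
  have := @sum_tail_le (walk_weight R q) [set i | (0 < i)%N] 1 N
     (fun i => ltW (walk_weight_gt0 i)) walk_weightS isT (fun i => id).
  have := walk_weight_gt0 0.
  case: N => [w0|N w0]; first by rewrite !big_nil => ?; lra.
  rewrite !big_nat_recl //= ifF; last first.
    by apply/negbTE/negP => /set_mem.
  under eq_bigr do rewrite ifT ?inE//.
  lra.
by rewrite ltry.
Qed.

Let W_gt0 : 0 < W.
Proof.
apply: lt_le_trans (walk_weight_gt0 0) _.
by rewrite -lee_fin fineK// -[leLHS]/((fun k => (walk_weight R q k)%:E) 0)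
  esum_ge_term.
Qed.

Lemma walk_measure_gt0 n : 0 < walk_measure R q n.
Proof. by rewrite divr_gt0// walk_weight_gt0. Qed.

Lemma walk_measureS n : walk_measure R q n.+2 = walk_measure R q n.+1 / q%:R.
Proof. by rewrite /walk_measure walk_weightS mulrAC. Qed.

Lemma walk_measure_sum N : \sum_(0 <= i < N) walk_measure R q i <= 1.
Proof.
rewrite -mulr_suml ler_pdivrMr ?mul1r// -lee_fin fineK//.
rewrite -sumEFin -nneseries_esumT; last first.
  by move=> i; rewrite lee_fin ltW// walk_weight_gt0.
by apply: nneseries_lim_ge => i _; rewrite lee_fin ltW// walk_weight_gt0.
Qed.

Lemma walk_measure_esum (S : set nat) :
  (\esum_(i in S) (walk_measure R q i)%:E <= 1)%E.
Proof.
by apply: esum_nat_ub walk_measure_sum => i; exact/ltW/walk_measure_gt0.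
Qed.

Local Notation mass := (mass (walk_measure R q)).
Local Notation flow := (flow (walk R q) (walk_measure R q)).

Lemma walk_mass_fin (S : set nat) :
  \esum_(i in S) (walk_measure R q i)%:E \is a fin_num.
Proof.
apply: esum_pos_fin => [i|]; first by rewrite lee_fin ltW// walk_measure_gt0.
by rewrite (le_lt_trans (walk_measure_esum S))// ltry.
Qed.

Lemma mass_le1 S : mass S <= 1.
Proof. by rewrite -lee_fin fineK ?walk_mass_fin// walk_measure_esum. Qed.

Lemma mass_gt0 S n : S n -> 0 < mass S.
Proof.
move=> Sn; apply: lt_le_trans (walk_measure_gt0 n) _.
rewrite -lee_fin fineK ?walk_mass_fin//.
by rewrite -[leLHS]/((fun k => (walk_measure R q k)%:E) n) esum_ge_term.
Qed.

Lemma mass_tail S n : (0 < n)%N -> (forall i, S i -> (n <= i)%N) ->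
  mass S <= q%:R / (q%:R - 1) * walk_measure R q n.
Proof.
move=> n0 nS; rewrite -lee_fin fineK ?walk_mass_fin// esum_mkcond.
have m0 i := ltW (walk_measure_gt0 i).
under eq_esum do rewrite -[0%E]/(0%:E) -(fun_if EFin).
apply: esum_nat_ub => [i|N]; first by case: ifP.
by apply: sum_tail_le => //; exact: walk_measureS.
Qed.

Lemma walk_ge0 x y : 0 <= walk R q x y.
Proof.
have h2 := qge2.
by rewrite /walk; do !case: ifP => // _; apply: divr_ge0; lra.
Qed.

Lemma walk_le x y : walk R q x y <= (y == x.+1)%:R + (y == x.-1)%:R.
Proof.
have h2 := qge2.
rewrite /walk; have [->|_] := eqVneq x 0%N; first by rewrite lerDl.
have q1 : 0 < q%:R + 1 :> R by lra.
case: (y == x.+1); last case: (y == x.-1); rewrite /= ?add0r//.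
  apply: (@le_trans _ _ 1); last by rewrite lerDl.
  by rewrite ler_pdivrMr//; lra.
by rewrite ler_pdivrMr//; lra.
Qed.

(** The sums in [mass] and [flow] are projected to the reals by [fine], so their
    finiteness has to be known before they can be bounded term by term. *)
Lemma flow_fin (E : set (nat * nat)) :
  \esum_(e in E) (walk_measure R q e.1 * walk R q e.1 e.2)%:E \is a fin_num.
Proof.
have h2 := qge2.
have pos x y : (0 <= (walk_measure R q x * walk R q x y)%:E)%E.
  by rewrite lee_fin mulr_ge0 ?walk_ge0// ltW// walk_measure_gt0.
apply: esum_pos_fin => [[x y]|]; first exact: pos.
apply: le_lt_trans (ltry 2).
apply: le_trans (esum_sub _ (@subsetT _ E)) _.
have -> : [set: nat * nat] = [set: nat] `*`` (fun=> [set: nat]).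
  by apply/seteqP; split.
rewrite -(@esum_esum R nat nat setT (fun=> setT)
  (fun x y => (walk_measure R q x * walk R q x y)%:E) (fun x y _ _ => pos x y)).
apply: (@le_trans _ _ (\esum_(x in [set: nat]) (2 * walk_measure R q x)%:E)).
  apply: le_esum => x _; apply: esum_nat_ub => [y|N].
    by have := pos x y; rewrite lee_fin.
  rewrite -mulr_sumr mulrC ler_pM2r ?walk_measure_gt0//.
  have sum1 (c : nat) : \sum_(0 <= y < N) (y == c)%:R <= 1 :> R.
    under eq_bigr do rewrite mulrb.
    by rewrite -big_mkcond big_nat1_eq; case: ifP.
  apply: le_trans (ler_sum_nat (fun y _ => walk_le x y)) _.
  rewrite big_split /=.
  by have := sum1 x.+1; have := sum1 x.-1; lra.
apply: esum_nat_ub => [x|N]; first by rewrite mulr_ge0// ltW// walk_measure_gt0.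
by rewrite -mulr_sumr; have := walk_measure_sum N; lra.
Qed.

Lemma flow_ge E x y : E (x, y) -> walk_measure R q x * walk R q x y <= flow E.
Proof.
move=> Exy; rewrite -lee_fin fineK ?flow_fin//.
rewrite -[leLHS]/((fun e => (walk_measure R q e.1 * walk R q e.1 e.2)%:E) (x, y)).
exact: esum_ge_term.
Qed.

Lemma walk_reversible n : walk_measure R q n * walk R q n n.+1 =
  walk_measure R q n.+1 * (q%:R / (q%:R + 1)).
Proof.
have h2 := qge2.
rewrite /walk /walk_measure; case: n => [|n] /=.
  by rewrite walk_weight1 mulr1 mulrAC.
rewrite eqxx walk_weightS; field.
by do ?[apply/andP; split] => //; apply: lt0r_neq0; have := W_gt0; rewrite /W; lra.
Qed.

Lemma walk_down n : walk R q n.+1 n = q%:R / (q%:R + 1).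
Proof. by rewrite /walk /= eqxx ifF//; lia. Qed.

Theorem cheeger_walk_ge :
  (q%:R - 1) / (q%:R + 1) <= cheeger (walk R q) (walk_measure R q).
Proof.
have h2 := qge2.
apply: lb_le_inf.
  exists (flow ([set 0%N] `*` ~` [set 0%N]) / (mass [set 0%N] * mass (~` [set 0%N]))).
  exists [set 0%N] => //; split; first by exists 0%N.
  by apply/eqP => /seteqP[_ /(_ 1%N Logic.I)].
move=> _ [S [S0 /eqP ST] <-].
have SC0 : (~` S) !=set0.
  apply/set0P/eqP => SC; apply: ST.
  by rewrite -[S]setCK SC setC0.
have [x Sx] := S0; have [y Sy] := SC0.
have mS := mass_gt0 Sx; have mSC := mass_gt0 Sy.
rewrite ler_pdivlMr ?mulr_gt0//.
have key (T U : set nat) n : T n.+1 ->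
    (forall i, T i -> (n.+1 <= i)%N) -> mass U <= 1 -> 0 < mass U ->
    (q%:R - 1) / (q%:R + 1) * (mass T * mass U) <=
    walk_measure R q n.+1 * (q%:R / (q%:R + 1)).
  move=> Tn nT U1 U0; have := mass_tail (ltn0Sn n) nT.
  have m0 := mass_gt0 Tn.
  move=> mT; apply: (@le_trans _ _ ((q%:R - 1) / (q%:R + 1) *
      (q%:R / (q%:R - 1) * walk_measure R q n.+1))).
    rewrite ler_wpM2l//; first by apply: divr_ge0; lra.
    by apply: le_trans mT; rewrite ler_piMr// ltW.
  rewrite le_eqVlt; apply/orP; left; apply/eqP; field.
  by do ?[apply/andP; split] => //; apply: lt0r_neq0; lra.
(* to be applied to the one of S and its complement that misses x_0 *)
have minimal (T : set nat) : T !=set0 -> ~ T 0%N -> exists n, [/\ T n.+1, ~ T n &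
    forall i, T i -> (n.+1 <= i)%N].
  move=> [z Tz] T0.
  have ex : exists i, i \in T by exists z; exact/mem_set.
  case: (ex_minnP ex) => [[|n] /set_mem Tn nmin] //.
  exists n; split => // [Tn'|i Ti]; last exact/nmin/mem_set.
  by have := nmin _ (mem_set Tn'); rewrite ltnn.
have [S0'|S0'] := pselect (S 0%N).
  have [n [Tn Tn' nT]] := minimal _ SC0 (fun h => h S0').
  have Sn : S n by apply: contrapT.
  rewrite [mass S * _]mulrC; apply: le_trans (key _ S n Tn nT _ mS) _.
    exact: mass_le1.
  by rewrite -walk_reversible; apply: flow_ge.
have [n [Tn Tn' nT]] := minimal _ S0 S0'.
apply: le_trans (key _ (~` S) n Tn nT _ mSC) _; first exact: mass_le1.
by rewrite -(walk_down n); apply: flow_ge.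
Qed.

End Cheeger.

(** * Two by two matrices *)

Section Mx2.
Variable R : comNzRingType.

Definition mx2 (a b c d : R) : 'M[R]_2 :=
  \matrix_(i, j) if i == 0 then (if j == 0 then a else b)
                 else (if j == 0 then c else d).

Lemma ord2P (i : 'I_2) : i = 0 \/ i = 1.
Proof. by case: i => [[|[|//]] ?]; [left|right]; apply: val_inj. Qed.

Lemma mx2_eta (A : 'M[R]_2) : A = mx2 (A 0 0) (A 0 1) (A 1 0) (A 1 1).
Proof. by apply/matrixP => i j; rewrite mxE; case: (ord2P i) (ord2P j) => -> [] ->. Qed.

Lemma mul_mx2 a b c d a' b' c' d' : mx2 a b c d *m mx2 a' b' c' d' =
  mx2 (a * a' + b * c') (a * b' + b * d') (c * a' + d * c') (c * b' + d * d').
Proof.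
apply/matrixP => i j; rewrite !mxE !big_ord_recl big_ord0 addr0 !mxE.
by case: (ord2P i) (ord2P j) => -> [] ->.
Qed.

Lemma scale_mx2 x a b c d : x *: mx2 a b c d = mx2 (x * a) (x * b) (x * c) (x * d).
Proof.
by apply/matrixP => i j; rewrite !mxE; case: (ord2P i) (ord2P j) => -> [] ->.
Qed.

Lemma one_mx2 : 1%:M = mx2 1 0 0 1.
Proof.
by apply/matrixP => i j; rewrite !mxE; case: (ord2P i) (ord2P j) => -> [] ->.
Qed.

Lemma det_mx2 a b c d : \det (mx2 a b c d) = a * d - b * c.
Proof.
rewrite (expand_det_row _ 0) !big_ord_recl big_ord0 addr0 /cofactor !det_mx11.
by rewrite !mxE /= expr0 expr1 mul1r mulN1r mulrN.
Qed.

Lemma mx2_det (A : 'M[R]_2) : \det A = A 0 0 * A 1 1 - A 0 1 * A 1 0.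
Proof. by rewrite {1}[A]mx2_eta det_mx2. Qed.

Lemma mulmx2E (A B : 'M[R]_2) i j : (A *m B) i j = A i 0 * B 0 j + A i 1 * B 1 j.
Proof.
rewrite !mxE !big_ord_recl big_ord0 addr0.
by congr (_ + A i _ * B _ j); apply: val_inj.
Qed.
End Mx2.

Lemma map_mx2 (R S : comNzRingType) (f : R -> S) a b c d :
  map_mx f (mx2 a b c d) = mx2 (f a) (f b) (f c) (f d).
Proof.
by apply/matrixP => i j; rewrite !mxE; case: (ord2P i) (ord2P j) => -> [] ->.
Qed.

(** * Laurent series *)

Section Laurent.
Variable F : fieldType.
Local Notation K := (laurent F).
Implicit Types (f g : K) (a b : int).

Lemma belowD f g a : below f a -> below g a -> below (f + g) a.
Proof. by move=> fa ga n na; rewrite lcoefD fa// ga// addr0. Qed.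

Lemma lcoefN f n : (- f) n = - f n. Proof. by []. Qed.

Lemma belowN f a : below f a -> below (- f) a.
Proof. by move=> fa n na; rewrite lcoefN fa// oppr0. Qed.

Lemma belowB f g a : below f a -> below g a -> below (f - g) a.
Proof. by move=> fa ga; apply/belowD/belowN. Qed.

Lemma belowM f g a b : below f a -> below g b -> below (f * g) (a + b).
Proof. exact: below_mul. Qed.

Lemma belowM0 f g a : below f a -> below g 0 -> below (f * g) a.
Proof. by move=> fa g0; rewrite -[a]addr0; exact: belowM. Qed.

Lemma lead_mul f g a b : below f a -> below g b -> (f * g) (a + b) = f a * g b.
Proof.
move=> fa gb; have := lconv_window 0 fa gb.
by rewrite big_ord_recl big_ord0 /= !addr0 => <-.
Qed.

Lemma lead_mul0 f g : below f 0 -> below g 0 -> (f * g) 0 = f 0 * g 0.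
Proof. by move=> f0 g0; have := lead_mul f0 g0; rewrite addr0. Qed.

Lemma coef_neq0 f n : f n != 0 -> f != 0.
Proof. by apply: contraNneq => ->; rewrite lcoef0. Qed.

(** The lowest term of f^-1 is the inverse of that of f, because lowest terms
    multiply. *)
Lemma below_inv f : below f 0 -> f 0 != 0 -> below f^-1 0 /\ f^-1 0 != 0.
Proof.
move=> f0 ff; have fn0 := coef_neq0 ff.
have [v fv vf] : exists2 v, f^-1 v != 0 & below f^-1 v.
  by apply: lval_ex; rewrite invr_eq0.
have := lead_mul f0 vf; rewrite divff// add0r lcoef1 => /esym/eqP.
have [<-|v0] := eqVneq v 0; first by [].
by rewrite mulf_eq0 (negPf ff) (negPf fv).
Qed.

Local Notation t := (laurent_t F).

Lemma lmonomM a b : lmonom a 1 * lmonom b 1 = lmonom (a + b) (1 : F).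
Proof.
apply: laurent_ext => n.
rewrite -[LHS]/(lmul (lmonom a 1) (lmonom b 1) n) lmul_monom mul1r /=.
by rewrite subr_eq addrC.
Qed.

Lemma laurent_tX (n : nat) : t ^+ n = lmonom (- n%:Z) 1.
Proof.
elim: n => [//|n IHn]; rewrite exprS IHn /laurent_t lmonomM.
by congr lmonom; lia.
Qed.

Lemma laurent_tVX (n : nat) : t ^- n = lmonom n%:Z 1.
Proof.
have e : lmonom n%:Z 1 * t ^+ n = 1 by rewrite laurent_tX lmonomM subrr.
by rewrite -[RHS](mulfK (_ : t ^+ n != 0)) ?e ?mul1r//; apply: contraTneq isT;
  move=> t0; move: e; rewrite t0 mulr0 => /esym/eqP; rewrite oner_eq0.
Qed.

Lemma laurent_t_neq0 : t != 0.
Proof. by apply: (@coef_neq0 _ (-1)); rewrite /= oner_eq0. Qed.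

Lemma coef_tXM (n : nat) f a : (t ^+ n * f) a = f (a + n%:Z).
Proof.
rewrite laurent_tX -[LHS]/(lmul (lmonom _ _) f a) lmul_monom mul1r.
by congr (f _); lia.
Qed.

Lemma coef_tM f a : (t * f) a = f (a + 1).
Proof. by rewrite -[t]expr1 coef_tXM. Qed.

Lemma coef_tVXM (n : nat) f a : (t ^- n * f) a = f (a - n%:Z).
Proof.
by rewrite laurent_tVX -[LHS]/(lmul (lmonom _ _) f a) lmul_monom mul1r.
Qed.

Lemma below_tM f : below f 0 -> f 0 = 0 -> below (t * f) 0.
Proof.
move=> f0 ff n n0; rewrite coef_tM.
have [->//|n1] := eqVneq (n + 1) 0.
by apply: f0; lia.
Qed.

Lemma below_tVM f : below f 0 -> below (t^-1 * f) 1.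
Proof. by move=> f0 n n1; rewrite -[t]expr1 coef_tVXM f0//; lia. Qed.

Lemma coefCM (c : F) f n : (laurentC c * f) n = c * f n.
Proof. by rewrite -[LHS]/(lmul (lmonom _ _) f n) lmul_monom subr0. Qed.

Lemma belowCM (c : F) f a : below f a -> below (laurentC c * f) a.
Proof. by move=> fa n na; rewrite coefCM fa// mulr0. Qed.

Lemma belowC (c : F) : below (laurentC c) 0.
Proof. by move=> n n0 /=; rewrite ifF//; apply/eqP => n0'; lia. Qed.

Lemma coefC0 (c : F) : laurentC c 0 = c. Proof. by []. Qed.

Local Notation lop := (@laurent_of_poly F).

Lemma lopC c : lop c%:P = laurentC c.
Proof. by rewrite /laurent_of_poly map_polyC hornerC. Qed.

Lemma lopX : lop 'X = t.
Proof. by rewrite /laurent_of_poly map_polyX hornerX. Qed.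

Lemma lop0 : lop 0 = 0. Proof. exact: rmorph0. Qed.
Lemma lop1 : lop 1 = 1. Proof. exact: rmorph1. Qed.
Lemma lopD p q : lop (p + q) = lop p + lop q. Proof. exact: rmorphD. Qed.
Lemma lopN p : lop (- p) = - lop p. Proof. exact: rmorphN. Qed.
Lemma lopM p q : lop (p * q) = lop p * lop q. Proof. exact: rmorphM. Qed.
Lemma lopXn (n : nat) : lop ('X ^+ n) = t ^+ n.
Proof. by rewrite -lopX; exact: rmorphXn. Qed.

Lemma coef_lop_gt0 p (n : int) : 0 < n -> lop p n = 0.
Proof.
elim/poly_ind: p n => [|p c IHp] n n0; first by rewrite lop0.
rewrite lopD lopM lopX lopC lcoefD mulrC coef_tM IHp ?add0r//=; last lia.
by rewrite ifF//; apply/eqP; lia.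
Qed.

(** A polynomial that vanishes at infinity is zero. *)
Lemma lop_small p v : 0 < v -> below (lop p) v -> lop p = 0.
Proof.
move=> v0 pv; apply: laurent_ext => n; rewrite lcoef0.
by have [/pv//|vn] := ltP n v; rewrite coef_lop_gt0//; exact: lt_le_trans vn.
Qed.

(** * The maximal compact subgroup *)

Implicit Types (A B X : 'M[K]_2).

(** GL_2(F[[1/t]]). *)
Definition GL2O (B : 'M[K]_2) :=
  (forall i j, below (B i j) 0) /\ (\det B) 0 != 0.

Lemma GL2O_det B : (forall i j, below (B i j) 0) -> below (\det B) 0 /\
  (\det B) 0 = B 0 0 0 * B 1 1 0 - B 0 1 0 * B 1 0 0.
Proof.
move=> B0; rewrite mx2_det; split.
  by apply: belowB; apply: belowM0.
by rewrite lcoefD lcoefN !lead_mul0.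
Qed.

Lemma GL2O_mul A B : GL2O A -> GL2O B -> GL2O (A *m B).
Proof.
move=> [A0 detA] [B0 detB]; split.
  by move=> i j; rewrite mulmx2E; apply: belowD; apply: belowM0.
rewrite det_mulmx lead_mul0 ?mulf_neq0//; first exact: (GL2O_det A0).1.
exact: (GL2O_det B0).1.
Qed.

Lemma GL2O_unit A : GL2O A -> A \in unitmx.
Proof. by case=> _ /coef_neq0 A0; rewrite unitmxE unitfE. Qed.

Lemma GL2O_inv A : GL2O A -> GL2O (invmx A).
Proof.
move=> OA; have Au := GL2O_unit OA; have [A0 detA] := OA.
have [iA iA0] := below_inv (GL2O_det A0).1 detA.
split; last by rewrite det_inv.
move=> i j; rewrite /invmx Au mxE; apply: belowM0 => //.
rewrite mxE /cofactor det_mx11 !mxE -signr_odd.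
by case: (odd _); rewrite ?expr0 ?expr1 ?mul1r ?mulN1r//; exact: belowN.
Qed.

Lemma GL2O_const (B : 'M[F]_2) : B \in unitmx -> GL2O (map_mx (@laurentC F) B).
Proof.
move=> Bu; split=> [i j|]; first by rewrite mxE; exact: belowC.
by rewrite det_map_mx coefC0 -unitfE -unitmxE.
Qed.

(** * The level of a matrix *)

Implicit Types (n m : nat).

Definition dmx (n : nat) : 'M[K]_2 := mx2 1 0 0 (t ^+ n).

(** The n for which A lies in GL_2(F[t]) K^* diag(1, t^n) GL_2(F[[1/t]]): the
    vertex of the tree given by A lies above the point x_n of the half-line. *)
Definition level (A : 'M[K]_2) (n : nat) :=
  exists (P : 'M[{poly F}]_2) (c : K) (B : 'M[K]_2),
    [/\ P \in unitmx, c != 0, GL2O B & map_mx lop P *m A = c *: (dmx n *m B)].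

Lemma level_mulr A n X : level A n -> GL2O X -> level (A *m X) n.
Proof.
move=> [P [c [B [Pu c0 OB e]]]] OX; exists P, c, (B *m X); split => //.
  exact: GL2O_mul.
by rewrite mulmxA e -scalemxAl mulmxA.
Qed.

Lemma det_lop (P : 'M[{poly F}]_2) : \det (map_mx lop P) = lop (\det P).
Proof. exact: det_map_mx. Qed.

Lemma map_lopM (P Q : 'M[{poly F}]_2) :
  map_mx lop (P *m Q) = map_mx lop P *m map_mx lop Q.
Proof. exact: map_mxM. Qed.

Lemma map_lop_unit (P : 'M[{poly F}]_2) : P \in unitmx -> map_mx lop P \in unitmx.
Proof. by rewrite !unitmxE det_map_mx; exact: rmorph_unit. Qed.

Lemma level_mull (P : 'M[{poly F}]_2) A n : P \in unitmx ->
  level (map_mx lop P *m A) n -> level A n.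
Proof.
move=> Pu [Q [c [B [Qu c0 OB e]]]]; exists (Q *m P), c, B; split => //.
  by rewrite unitmx_mul Qu.
by rewrite map_lopM -mulmxA.
Qed.

Lemma level_scale d A n : d != 0 -> level A n -> level (d *: A) n.
Proof.
move=> d0 [P [c [B [Pu c0 OB e]]]]; exists P, (d * c), B; split => //.
  by rewrite mulf_neq0.
by rewrite -scalemxAr e scalerA.
Qed.

Lemma level_scaleV d A n : d != 0 -> level (d *: A) n -> level A n.
Proof.
move=> d0 /(level_scale (_ : d^-1 != 0)); rewrite scalerA mulVf// scale1r.
by apply; rewrite invr_eq0.
Qed.

Lemma level_dmx n B : GL2O B -> level (dmx n *m B) n.
Proof.
move=> OB; exists 1%:M, 1, B; split; rewrite ?unitmx1 ?oner_eq0//.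
by rewrite map_mx1 mul1mx scale1r.
Qed.

(** If m < n, comparing determinants shows that c has positive valuation; then
    the entries of the first row of P vanish at infinity, hence are zero, which
    is impossible for an invertible matrix. *)
Lemma dmx_not_lt (P : 'M[{poly F}]_2) c B n m : P \in unitmx -> c != 0 ->
  GL2O B -> map_mx lop P *m dmx m = c *: (dmx n *m B) -> (n <= m)%N.
Proof.
move=> Pu c0 [B0 detB] e; rewrite leqNgt; apply/negP => mn.
have [v cv vc] := lval_ex c0.
have Pdet := map_lop_unit Pu.
have [a a0 aE] : exists2 a : F, a != 0 & lop (\det P) = laurentC a.
  move: Pu; rewrite unitmxE poly_unitE => /andP[/size_poly1P[a a0 ->] _].
  by exists a => //; rewrite lopC.
(* the determinants give 2 v = n - m *)
have v0 : 0 < v.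
  have := congr1 determinant e.
  rewrite detZ !det_mulmx det_lop aE !det_mx2 !mulr0 !mul1r !subr0.
  move=> /(congr1 (fun f : K => f (2 * v - n%:Z))).
  rewrite coefCM laurent_tX expr2 mulrCA [RHS]coef_tXM.
  have -> : 2 * v - n%:Z + n%:Z = v + v + 0 by lia.
  rewrite lead_mul ?lead_mul//; last 2 first.
  - exact: belowM.
  - exact: (GL2O_det B0).1.
  rewrite /=; case: eqP => [vn _|_ /esym/eqP]; first by lia.
  by rewrite mulr0 !mulf_eq0 (negPf cv) (negPf detB).
have row0 j : (map_mx lop P *m dmx m) 0 j = c * B 0 j.
  by rewrite e mxE mulmx2E !mxE /= mul1r mul0r addr0.
have P00 : lop (P 0 0) = 0.
  apply: (lop_small v0); have := row0 0; rewrite mulmx2E !mxE /= mulr1 mulr0 addr0.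
  by move=> ->; exact: belowM0.
have P01 : lop (P 0 1) = 0.
  apply: (@lop_small _ (v + m%:Z)); first by lia.
  have := row0 1; rewrite mulmx2E !mxE /= mulr0 add0r => e1.
  have <- : t ^- m * (c * B 0 1) = lop (P 0 1).
    by rewrite -e1 mulrC mulfK// expf_neq0// laurent_t_neq0.
  move=> k kv; rewrite coef_tVXM; apply: (belowM0 vc (B0 _ _)); lia.
move: Pdet; rewrite unitmxE mx2_det !mxE P00 P01 !mul0r subr0.
by rewrite unitr0.
Qed.

Lemma level_uniq A n m : level A n -> level A m -> n = m.
Proof.
move=> Hn Hm; suff key i j : level A i -> level A j -> (i <= j)%N.
  by apply/eqP; rewrite eqn_leq !key.
move=> {Hn Hm} [P [c [B [Pu c0 OB e]]]] [Q [d [C [Qu d0 OC e']]]].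
apply: (@dmx_not_lt (P *m invmx Q) (c / d) (B *m invmx C)).
- by rewrite unitmx_mul Pu unitmx_inv.
- by rewrite mulf_neq0// invr_eq0.
- exact/GL2O_mul/GL2O_inv.
have Cu := GL2O_unit OC.
have -> : dmx j = d^-1 *: (map_mx lop Q *m A *m invmx C).
  by rewrite e' -scalemxAl mulmxK// scalerA mulVf// scale1r.
have PQ : map_mx lop (P *m invmx Q) *m map_mx lop Q = map_mx lop P.
  by rewrite -map_lopM mulmxKV.
rewrite -scalemxAr !mulmxA PQ e -!scalemxAl scalerA.
by rewrite [d^-1 * c]mulrC.
Qed.

(** By induction on the valuation delta of the determinant.  While it is
    positive, the constant terms of the rows of B are linearly dependent, and a
    row operation with polynomial coefficients makes a row divisible by 1/t;
    moving this factor into the diagonal matrix decreases delta. *)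
Lemma dmx_reduce (delta n : nat) (B : 'M[K]_2) :
  (forall i j, below (B i j) 0) -> (\det B) delta%:Z != 0 ->
  exists m, level (dmx n *m B) m.
Proof.
elim: delta n B => [|delta IH] n B B0 detB.
  by exists n; apply: level_dmx.
have [detB0|] := eqVneq ((\det B) 0) 0; last by exists n; exact: level_dmx.
have tn0 := laurent_t_neq0.
move: detB0; rewrite (GL2O_det B0).2 => /eqP; rewrite subr_eq0 => /eqP det0.
move: B0 det0 detB; rewrite [B]mx2_eta.
move: (B 0 0) (B 0 1) (B 1 0) (B 1 1) => a b c d B0.
have a0 : below a 0 by have := B0 0 0; rewrite mxE.
have b0 : below b 0 by have := B0 0 1; rewrite mxE.
have c0 : below c 0 by have := B0 1 0; rewrite mxE.
have d0 : below d 0 by have := B0 1 1; rewrite mxE.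
rewrite !mxE /= det_mx2 => det0 detB.
have mx2O (x y z w : K) : below x 0 -> below y 0 -> below z 0 -> below w 0 ->
    forall i j, below (mx2 x y z w i j) 0.
  by move=> ? ? ? ? i j; rewrite mxE; do 2?case: ifP.
(* the first row of B is divisible by 1/t *)
have [/andP[/eqP aa /eqP bb]|ab] := boolP ((a 0 == 0) && (b 0 == 0)).
  have [] := IH n.+1 (mx2 (t * a) (t * b) c d).
  - by apply: mx2O => //; exact: below_tM.
  - rewrite det_mx2 -!mulrA -mulrBr coef_tM.
    by rewrite (_ : delta%:Z + 1 = delta.+1%:Z)//; lia.
  move=> m lm; exists m; apply: (level_scaleV tn0); congr (level _ m): lm.
  by rewrite !mul_mx2 scale_mx2; congr mx2; rewrite ?exprS; ring.
(* otherwise the second row minus x times the first one is *)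
have [x [cx dx]] : exists x, c 0 = x * a 0 /\ d 0 = x * b 0.
  have [aa|aa] := eqVneq (a 0) 0.
    move: ab det0; rewrite aa eqxx /= mul0r => bb /esym/eqP.
    rewrite mulf_eq0 (negPf bb) /= => /eqP ->.
    by exists (d 0 / b 0); rewrite mulr0 divfK.
  exists (c 0 / a 0); rewrite divfK//; split=> //.
  by apply: (mulfI aa); rewrite det0; field.
set c' := t * (c - laurentC x * a); set d' := t * (d - laurentC x * b).
have c'0 : below c' 0.
  apply: below_tM; first by apply: belowB => //; exact: belowCM.
  by rewrite lcoefD lcoefN coefCM cx subrr.
have d'0 : below d' 0.
  apply: below_tM; first by apply: belowB => //; exact: belowCM.
  by rewrite lcoefD lcoefN coefCM dx subrr.
have detB' : (a * d' - b * c') delta%:Z != 0.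
  have -> : a * d' - b * c' = t * (a * d - b * c) by rewrite /c' /d'; ring.
  by rewrite coef_tM (_ : delta%:Z + 1 = delta.+1%:Z)//; lia.
(* dividing the second row of diag(1, 1) B by t and exchanging the rows gives
   t^-1 diag(1, t) *)
case: n => [|n].
  have [] := IH 1%N (mx2 c' d' a b).
  - exact: mx2O.
  - by rewrite det_mx2 -opprB lcoefN oppr_eq0 mulrC [c' * b]mulrC.
  move=> m lm; exists m.
  apply: (@level_mull (mx2 (- x%:P) 1 1 0)).
    by rewrite unitmxE det_mx2 mulr0 mulr1 sub0r unitrN unitr1.
  apply: (level_scaleV tn0); congr (level _ m): lm.
  rewrite map_mx2 !mul_mx2 scale_mx2 lopN (lopC x) !lop1 lop0.
  by rewrite /c' /d'; congr mx2; rewrite ?expr1 ?expr0; ring.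
have [] := IH n (mx2 a b c' d').
- exact: mx2O.
- by rewrite det_mx2.
move=> m lm; exists m.
apply: (@level_mull (mx2 1 0 (- (x%:P * 'X ^+ n.+1)) 1)).
  by rewrite unitmxE det_mx2 mulr1 mul0r subr0 unitr1.
congr (level _ m): lm.
rewrite map_mx2 !mul_mx2 lopN lopM lopXn (lopC x) !lop1 lop0.
by rewrite /c' /d'; congr mx2; rewrite ?exprS; ring.
Qed.

Lemma mx_below_ex A : exists N : nat, forall i j, below (A i j) (- N%:Z).
Proof.
have ex i j : exists N : nat, below (A i j) (- N%:Z).
  by have [a fa] := below_ex (A i j); exists `|a|%N; apply: below_le fa; lia.
have [f fA] := choice (fun ij : 'I_2 * 'I_2 => ex ij.1 ij.2).
exists (\max_ij f ij) => i j; apply: below_le (fA (i, j)).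
by have := leq_bigmax (F := f) (i, j); lia.
Qed.

Lemma level_ex A : A \in unitmx -> exists n, level A n.
Proof.
move=> Au.
have [N AN] := mx_below_ex A.
have tX0 k : t ^+ k != 0 by rewrite expf_neq0 // laurent_t_neq0.
pose B := t ^- N *: A.
have B0 i j : below (B i j) 0.
  by move=> k k0; rewrite mxE coef_tVXM AN//; lia.
have detB : \det B != 0.
  by rewrite detZ mulf_neq0 ?expf_neq0 ?invr_eq0//; rewrite -unitfE -unitmxE.
have [v Bv vB] := lval_ex detB.
have v0 : 0 <= v.
  rewrite leNgt; apply/negP => v0; move: Bv.
  by rewrite (GL2O_det B0).1 ?eqxx.
have [m Bm] : exists m, level (dmx 0 *m B) m.
  by apply: (@dmx_reduce `|v|%N) => //; rewrite gez0_abs.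
exists m; apply: (@level_scaleV (t ^- N)); first by rewrite invr_eq0.
by congr (level _ m): Bm; rewrite /dmx expr0 -one_mx2 mul1mx.
Qed.

(** Multiplication by diag(t, 1) gives the first row of B, whose first entry is
    a unit, the valuation -1.  A row operation with polynomial coefficients
    cancels the term of highest degree of the second row, and a common factor t
    can be taken out. *)
Lemma level_down (P : 'M[{poly F}]_2) c A B n : P \in unitmx -> c != 0 ->
    GL2O B -> map_mx lop P *m A = c *: (dmx n.+1 *m B) -> B 0 0 0 != 0 ->
  level (A *m mx2 t 0 0 1) n.
Proof.
move=> Pu c0 OB e B00.
have [B0 detB] := OB; pose x := B 1 0 0 / B 0 0 0.
have tn0 := laurent_t_neq0.
pose B' := mx2 (B 0 0) (t^-1 * B 0 1) (t * (B 1 0 - laurentC x * B 0 0))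
               (B 1 1 - laurentC x * B 0 1).
exists (mx2 1 0 (- (x%:P * 'X ^+ n.+1)) 1 *m P), (c * t), B'; split.
- by rewrite unitmx_mul Pu unitmxE det_mx2 mulr1 mul0r subr0 unitr1.
- by rewrite mulf_neq0.
- split; last first.
    congr (_ != 0): detB; rewrite mx2_det det_mx2; congr (lcoef _ _).
    by field.
  move=> i j; rewrite mxE; case: ifP => _; case: ifP => _ //.
  + by apply: below_le (below_tVM _).
  + apply: below_tM; first by apply: belowB => //; exact: belowCM.
    by rewrite lcoefD lcoefN coefCM /x divfK// subrr.
  + by apply: belowB => //; exact: belowCM.
rewrite map_lopM -mulmxA [map_mx lop P *m _]mulmxA e -scalemxAl -scalemxAr.
rewrite -scalerA; congr (_ *: _); rewrite [B]mx2_eta /B' /dmx.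
rewrite map_mx2 !mul_mx2 scale_mx2.
rewrite lopN lopM lopXn (lopC x) !lop1 lop0.
by congr mx2; rewrite ?exprS; field.
Qed.

End Laurent.

(** * Density in square mean *)

Import HBNNSimple.

Section SquareMean.
Context {R : realType} {d : measure_display} {T : measurableType d}.
Variable m : probability T R.
Implicit Types (f g h : T -> R) (a b c e : R) (A B : set T).

(** The square of the L^2 norm, kept in the extended reals so that infinite
    integrals need no separate treatment in the inequalities below. *)
Definition sqint f : \bar R := (\int[m]_x ((f x) ^+ 2)%:E)%E.

Lemma sq_measurable f : measurable_fun setT f ->
  measurable_fun setT (fun x => ((f x) ^+ 2 : R)%:E).
Proof. by move=> mf; apply/measurable_EFinP; exact: measurable_funX. Qed.

Lemma sqint_ge0 f : (0 <= sqint f)%E.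
Proof. by apply: integral_ge0 => x _; rewrite lee_fin sqr_ge0. Qed.

Lemma sqint_eq f g : f =1 g -> sqint f = sqint g.
Proof. by move=> /funext ->. Qed.

(** A pointwise inequality between squares takes the place of the triangle
    inequality; the coefficients are chosen at each use. *)
Lemma sqint_comb f g h a b : measurable_fun setT f -> measurable_fun setT g ->
    measurable_fun setT h -> 0 <= a -> 0 <= b ->
    (forall x, (f x) ^+ 2 <= a * (g x) ^+ 2 + b * (h x) ^+ 2) ->
  (sqint f <= a%:E * sqint g + b%:E * sqint h)%E.
Proof.
move=> mf mg mh a0 b0 le.
rewrite /sqint -!ge0_integralZl_EFin//; do ?exact: sq_measurable;
  try by move=> x _; rewrite lee_fin sqr_ge0.
rewrite -ge0_integralD//; last 4 first.
- by move=> x _; rewrite -EFinM lee_fin mulr_ge0// sqr_ge0.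
- by under eq_fun do rewrite -EFinM; apply/measurable_EFinP;
    apply: measurable_funM => //; exact: measurable_funX.
- by move=> x _; rewrite -EFinM lee_fin mulr_ge0// sqr_ge0.
- by under eq_fun do rewrite -EFinM; apply/measurable_EFinP;
    apply: measurable_funM => //; exact: measurable_funX.
apply: ge0_le_integral => //.
- by move=> x _; rewrite lee_fin sqr_ge0.
- exact: sq_measurable.
- under eq_fun do rewrite -!EFinM -EFinD; apply/measurable_EFinP.
  by apply: measurable_funD; apply: measurable_funM => //; exact: measurable_funX.
- by move=> x _; rewrite -!EFinM -EFinD lee_fin.
Qed.

Lemma sqint_add f g a b : measurable_fun setT f -> measurable_fun setT g ->
    (sqint f <= a%:E)%E -> (sqint g <= b%:E)%E ->
  (sqint (fun x => (f x + g x)%R) <= (2 * a + 2 * b)%:E)%E.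
Proof.
move=> mf mg fa gb; apply: (@le_trans _ _ (2%:E * sqint f + 2%:E * sqint g)%E).
  apply: sqint_comb => //; first exact: measurable_funD.
  by move=> x; have := sqr_ge0 (f x - g x); lra.
by rewrite (EFinD (2 * a)) !EFinM leeD// lee_pmul2l.
Qed.

Lemma sqint_scale f a c : measurable_fun setT f -> (sqint f <= a%:E)%E ->
  (sqint (fun x => (c * f x)%R) <= (c ^+ 2 * a)%:E)%E.
Proof.
move=> mf fa; apply: (@le_trans _ _ ((c ^+ 2)%:E * sqint f + 0%:E * sqint f)%E).
  apply: sqint_comb => //; first exact: measurable_funM.
    exact: sqr_ge0.
  by move=> x; rewrite exprMn mul0r addr0.
by rewrite mul0e adde0 (EFinM _ a) lee_wpmul2l// lee_fin sqr_ge0.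
Qed.

(** The square-mean closure of a vector space C of measurable functions that
    contains the constants is all of L^2 as soon as it contains the indicators
    of a generating family of sets stable under intersection. *)
Section Closure.
Variable C : set (T -> R).
Hypothesis Cmeas : forall f, C f -> measurable_fun setT f.
Hypothesis C1 : C (cst 1).
Hypothesis CD : forall f g, C f -> C g -> C (fun x => f x + g x).
Hypothesis CZ : forall c f, C f -> C (fun x => c * f x).

Definition sq_approx f := measurable_fun setT f /\ forall e, 0 < e ->
  exists2 g, C g & (sqint (fun x => (f x - g x)%R) <= e%:E)%E.

Lemma approx_self f : C f -> sq_approx f.
Proof.
move=> Cf; split; first exact: Cmeas.
move=> e e0; exists f => //; rewrite /sqint integral0_eq ?lee_fin ?ltW//.
by move=> x _; rewrite subrr expr0n.
Qed.

Lemma approxD f g : sq_approx f -> sq_approx g -> sq_approx (fun x => f x + g x).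
Proof.
move=> [mf fC] [mg gC]; split; first exact: measurable_funD.
move=> e e0; have e4 : 0 < e / 4 by rewrite divr_gt0.
have [f' Cf' ff'] := fC _ e4; have [g' Cg' gg'] := gC _ e4.
exists (fun x => f' x + g' x); first exact: CD.
rewrite (sqint_eq (g := fun x => (f x - f' x) + (g x - g' x))); last first.
  by move=> x; ring.
apply: le_trans (sqint_add _ _ ff' gg') _; last by rewrite lee_fin; lra.
- by apply: measurable_funB => //; exact: Cmeas.
- by apply: measurable_funB => //; exact: Cmeas.
Qed.

Lemma approxZ c f : sq_approx f -> sq_approx (fun x => c * f x).
Proof.
move=> [mf fC]; split; first exact: measurable_funM.
move=> e e0; have c0 : 0 < c ^+ 2 + 1 by rewrite ltr_wpDl// sqr_ge0.
have [g Cg fg] := fC (e / (c ^+ 2 + 1)) (divr_gt0 e0 c0).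
exists (fun x => c * g x); first exact: CZ.
rewrite (sqint_eq (g := fun x => c * (f x - g x))); last by move=> x; ring.
apply: le_trans (sqint_scale _ _ fg) _.
  by apply: measurable_funB => //; exact: Cmeas.
by rewrite lee_fin mulrCA ler_piMr ?ltW// ltr_pdivrMr// mul1r ltrDl.
Qed.

Lemma approx_lim f : measurable_fun setT f ->
  (forall e, 0 < e -> exists2 g, sq_approx g & (sqint (fun x => (f x - g x)%R) <= e%:E)%E) ->
  sq_approx f.
Proof.
move=> mf fa; split=> // e e0; have e4 : 0 < e / 4 by rewrite divr_gt0.
have [g [mg ga] fg] := fa _ e4; have [h Ch gh] := ga _ e4.
exists h => //; rewrite (sqint_eq (g := fun x => (f x - g x) + (g x - h x))); last first.
  by move=> x; ring.
apply: le_trans (sqint_add _ _ fg gh) _; last by rewrite lee_fin; lra.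
- exact: measurable_funB.
- by apply: measurable_funB => //; exact: Cmeas.
Qed.

Lemma approx_sum (I : Type) (s : seq I) (F : I -> T -> R) :
  (forall i, sq_approx (F i)) -> sq_approx (fun x => \sum_(i <- s) F i x).
Proof.
move=> aF; elim: s => [|i s IH].
  rewrite (_ : (fun x => _) = fun x => 0 * cst 1 x).
    exact/approxZ/approx_self.
  by apply/funext => x; rewrite big_nil mul0r.
rewrite (_ : (fun x => _) = fun x => F i x + \sum_(j <- s) F j x).
  exact: approxD.
by apply/funext => x; rewrite big_cons.
Qed.

Lemma indicD A B x : B `<=` A -> \1_(A `\` B) x = \1_A x - \1_B x :> R.
Proof.
move=> BA; rewrite !indicE; have [xB|xB] := pselect (B x).
  by rewrite (mem_set (BA _ xB)) (mem_set xB) memNset ?subrr// => -[].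
have [xA|xA] := pselect (A x).
  by rewrite (mem_set xA) (memNset xB) subr0 mem_set.
by rewrite (memNset xA) (memNset xB) subr0 memNset// => -[].
Qed.

Lemma sqint_indicB A B : measurable A -> measurable B -> B `<=` A ->
  sqint (fun x => \1_A x - \1_B x) = m (A `\` B).
Proof.
move=> mA mB BA; rewrite -[in RHS](setIT (A `\` B)) -integral_indic//; last first.
  exact: measurableD.
apply: eq_integral => x _; rewrite -indicD// indicE.
by case: (_ \in _); rewrite ?expr1n ?expr0n.
Qed.

Lemma approx_bigcup (B : (set T)^nat) :
    {homo B : n k / (n <= k)%N >-> (n <= k)%O} ->
    (forall n, measurable (B n)) -> (forall n, sq_approx \1_(B n)) ->
  sq_approx \1_(\bigcup_n B n).
Proof.
move=> ndB mBi aB.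
have mUB : measurable (\bigcup_i B i) by exact: bigcupT_measurable.
apply: approx_lim; first exact: measurable_indic.
move=> e e0.
have cB := nondecreasing_cvg_mu mBi mUB ndB.
have fUB : m (\bigcup_i B i) \is a fin_num by exact: fin_num_measure.
have [N BN] : exists N, (m (\bigcup_i B i) - e%:E < m (B N))%E.
  have : nbhs (m (\bigcup_i B i)) [set z | (m (\bigcup_i B i) - e%:E < z)%E].
    apply: open_nbhs_nbhs; split; first exact: open_ereal_gt_ereal.
    by rewrite /= -(fineK fUB) -EFinB lte_fin ltrBlDr ltrDl.
  by move=> /cB[N _ NB]; exists N; apply: NB => /=.
exists (\1_(B N)); first exact: aB.
rewrite sqint_indicB//; last exact: bigcup_sup.
rewrite measureD//; last by rewrite -ge0_fin_numE.
rewrite setIidr; last exact: bigcup_sup.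
by rewrite leeBlDr ?fin_num_measure// -leeBlDl// ltW.
Qed.

Variable G : set (set T).
Hypothesis GI : setI_closed G.
Hypothesis measG : forall A, measurable A -> <<s setT, G >> A.
Hypothesis Gmeas : G `<=` measurable.
Hypothesis Gapprox : forall A, G A -> sq_approx \1_A.

(** The sets whose indicator lies in the closure form a Dynkin system, since
    the closure is a vector space stable under increasing limits of
    indicators. *)
Lemma approx_indic A : measurable A -> sq_approx \1_A.
Proof.
move=> /measG.
suff L : lambda_system setT [set B : set T | measurable B /\ sq_approx \1_B].
  move=> /(lambda_system_subset GI L) [] // B GB.
  by split; [exact: Gmeas|exact: Gapprox].
split=> //.
- split; first exact: measurableT.
  by rewrite indicT; exact: approx_self.
- move=> B B' BB' [mB aB] [mB' aB']; split; first exact: measurableD.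
  rewrite (_ : \1_(B `\` B') = fun x => \1_B x + (-1) * \1_B' x).
    exact/approxD/approxZ.
  by apply/funext => x; rewrite mulN1r indicD.
move=> B ndB mB; split; first by apply: bigcupT_measurable => i; exact: (mB i).1.
by apply: approx_bigcup => // n; [exact: (mB n).1|exact: (mB n).2].
Qed.

Lemma approx_nnsfun (f : {nnsfun T >-> R}) : sq_approx f.
Proof.
rewrite (_ : (f : T -> R) = fun x => \sum_(y <- finmap.enum_fset (fset_set (range f)))
    y * \1_(f @^-1` [set y]) x); last first.
  by apply/funext => x; rewrite fimfunE fsbig_finite.
by apply: approx_sum => y; apply/approxZ/approx_indic.
Qed.

(** Increasing simple approximations converge in square mean by dominated
    convergence: the square of the error is at most f^2. *)
Lemma approx_ge0 f : measurable_fun setT f -> (forall x, 0 <= f x) ->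
  (sqint f < +oo)%E -> sq_approx f.
Proof.
move=> mf f0 foo; apply: approx_lim => // e e0.
have mEf : measurable_fun setT (EFin \o f) by exact/measurable_EFinP.
pose h := nnsfun_approx measurableT mEf.
have f0' x : setT x -> (0 <= (EFin \o f) x)%E by move=> _; rewrite /= lee_fin.
have hf n x : h n x <= f x.
  by rewrite /h nnsfun_approxE -lee_fin; exact: (le_approx n f0').
have mfh n : measurable_fun setT (fun x => f x - h n x).
  by apply: measurable_funB => //; exact: measurable_funPT.
have cvgh : (fun n => sqint (fun x => f x - h n x)) @ \oo --> (\int[m]_x (0 : \bar R))%E.
  apply: (@dominated_cvg _ _ _ _ _ measurableT _ _ (fun x => ((f x) ^+ 2)%:E)) => //.
  - by move=> n; exact: sq_measurable.
  - move=> x _.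
    have cx := cvg_nnsfun_approx measurableT mEf f0' (Logic.I : setT x).
    have {}cx : (fun n => h n x) @ \oo --> f x by have /fine_cvgP[] := cx.
    have c1 : (fun n => f x - h n x) @ \oo --> f x - f x.
      by apply: cvgB => //; exact: cvg_cst.
    have := cvgM c1 c1; rewrite subrr mul0r => c0.
    by apply/cvg_EFin; [exact: nearW|exact: c0].
  - apply/integrableP; split; first exact: sq_measurable.
    apply: le_lt_trans foo; rewrite le_eqVlt; apply/orP; left; apply/eqP.
    by apply: eq_integral => x _; rewrite gee0_abs// lee_fin sqr_ge0.
  - move=> n x _; rewrite gee0_abs ?lee_fin ?sqr_ge0//.
    have hx := hf n x; have h0 : 0 <= h n x by [].
    by rewrite ler_sqr ?nnegrE ?subr_ge0// lerBlDr lerDl.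
rewrite integral0 in cvgh.
have : nbhs (0 : \bar R)%E [set z | (z < e%:E)%E].
  apply: open_nbhs_nbhs; split; first exact: open_ereal_lt_ereal.
  by rewrite /= lte_fin.
move=> /cvgh[N _ NB]; exists (h N); first exact: approx_nnsfun.
by apply/ltW/(NB N) => /=.
Qed.

Lemma approx_sqint f : measurable_fun setT f -> (sqint f < +oo)%E -> sq_approx f.
Proof.
move=> mf foo.
have part s : s ^+ 2 = 1 -> sq_approx (fun x => Num.max (s * f x) 0).
  move=> s2; have mg : measurable_fun setT (fun x => Num.max (s * f x) 0).
    by apply: measurable_maxr => //; exact: measurable_funM.
  apply: approx_ge0 => // [x|]; first by rewrite le_max lexx orbT.
  apply: le_lt_trans foo; apply: ge0_le_integral => //.
  - by move=> x _; rewrite lee_fin sqr_ge0.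
  - exact: sq_measurable.
  - exact: sq_measurable.
  move=> x _; rewrite lee_fin -[leRHS]mul1r -s2 -exprMn.
  by case: (leP (s * f x) 0) => _; rewrite ?lexx// expr0n sqr_ge0.
rewrite (_ : f = fun x => Num.max (1 * f x) 0 + (-1) * Num.max (- 1 * f x) 0).
  by apply/approxD/approxZ; apply: part; rewrite ?sqrrN expr1n.
apply/funext => x; rewrite mul1r !mulN1r.
by case: (leP (f x) 0) => fx; case: (leP (- f x) 0) => fx'; lra.
Qed.

End Closure.

Lemma sqint_le f g : measurable_fun setT f -> measurable_fun setT g ->
  (forall x, (f x) ^+ 2 <= (g x) ^+ 2) -> (sqint f <= sqint g)%E.
Proof.
move=> mf mg fg; apply: ge0_le_integral => //; do ?exact: sq_measurable.
- by move=> x _; rewrite lee_fin sqr_ge0.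
- by move=> x _; rewrite lee_fin.
Qed.

(** The variance of u is non-negative. *)
Lemma sq_avg_le (I : finType) (u : I -> R) : (0 < #|I|)%N ->
  (#|I|%:R^-1 * \sum_i u i) ^+ 2 <= #|I|%:R^-1 * \sum_i (u i) ^+ 2.
Proof.
move=> I0; set n : R := #|I|%:R; have n0 : 0 < n by rewrite ltr0n.
set s := \sum_i u i; set c := n^-1 * s.
have : 0 <= \sum_i (u i - c) ^+ 2 by apply: sumr_ge0 => i _; exact: sqr_ge0.
have -> : \sum_i (u i - c) ^+ 2 = \sum_i (u i) ^+ 2 - n * c ^+ 2.
  have e i : (u i - c) ^+ 2 = u i ^+ 2 + ((- 2 * c) * u i + c ^+ 2) by ring.
  under eq_bigr do rewrite e.
  rewrite !big_split /= -mulr_sumr -/s sumr_const -mulr_natl -/n.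
  have -> : s = n * c by rewrite /c mulrA divff ?mul1r// gt_eqF.
  ring.
rewrite subr_ge0 => h; rewrite -(ler_pM2l n0) [leRHS]mulrA divff ?gt_eqF// mul1r.
exact: h.
Qed.

Lemma sqint_avg (I : finType) (u : I -> T -> R) a : (0 < #|I|)%N ->
    (forall i, measurable_fun setT (u i)) -> (forall i, (sqint (u i) <= a%:E)%E) ->
  (sqint (fun x => (#|I|%:R^-1 * \sum_i u i x)%R) <= a%:E)%E.
Proof.
move=> I0 mu ua; have n0 : 0 < #|I|%:R :> R by rewrite ltr0n.
have mS : measurable_fun setT (fun x => \sum_i (u i x) ^+ 2).
  by apply: measurable_sum => i; exact: measurable_funX.
apply: (@le_trans _ _ (\int[m]_x ((#|I|%:R^-1)%:E * (\sum_i (u i x) ^+ 2)%:E))%E).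
  apply: ge0_le_integral => //.
  - by move=> x _; rewrite lee_fin sqr_ge0.
  - apply: sq_measurable; apply: measurable_funM => //.
    exact: measurable_sum.
  - under eq_fun do rewrite -EFinM.
    by apply/measurable_EFinP; exact: measurable_funM.
  - by move=> x _; rewrite -EFinM lee_fin sq_avg_le.
rewrite ge0_integralZl_EFin//; last 2 first.
- by move=> x _; rewrite lee_fin sumr_ge0// => i _; exact: sqr_ge0.
- exact/measurable_EFinP.
under eq_integral do rewrite -sumEFin.
rewrite ge0_integral_sum//; last 2 first.
- by move=> i; exact: sq_measurable.
- by move=> i x _; rewrite lee_fin sqr_ge0.
rewrite muleC lee_pdivrMr//.
apply: (@le_trans _ _ (\sum_(i : I) a%:E)%E); first by apply: lee_sum => i _; exact: ua.
by rewrite sumEFin lee_fin sumr_const mulr_natr.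
Qed.

(** A function of mean zero is orthogonal to the constants. *)
Lemma sqint_sub_cst f c : measurable_fun setT f -> (sqint f < +oo)%E ->
  (\int[m]_x (f x)%:E = 0)%E -> (sqint f <= sqint (fun x => (f x - c)%R))%E.
Proof.
move=> mf foo f0.
have if2 : m.-integrable setT (fun x => ((f x) ^+ 2)%:E).
  apply/integrableP; split; first exact: sq_measurable.
  apply: le_lt_trans foo; rewrite le_eqVlt; apply/orP; left; apply/eqP.
  by apply: eq_integral => x _; rewrite gee0_abs// lee_fin sqr_ge0.
have ic k : m.-integrable setT (fun=> k%:E).
  by apply: finite_measure_integrable_cst.
have iff : m.-integrable setT (fun x => (f x)%:E).
  apply: (@le_integrable _ _ _ _ _ measurableT _ (fun x => ((f x) ^+ 2)%:E + 1%:E)%E).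
  - exact/measurable_EFinP.
  - move=> x _; rewrite -EFinD lee_fin [leRHS]ger0_norm ?addr_ge0 ?sqr_ge0//.
    rewrite -(real_normK (num_real (f x))).
    by have := sqr_ge0 (`|f x| - 1); have := normr_ge0 (f x); nra.
  - exact: integrableD.
have icf : m.-integrable setT (fun x => (- (2 * c))%:E * (f x)%:E)%E.
  exact: integrableZl.
rewrite [leRHS](_ : _ =
    \int[m]_x (((f x) ^+ 2)%:E + ((- (2 * c))%:E * (f x)%:E + (c ^+ 2)%:E)))%E; last first.
  by apply: eq_integral => x _; rewrite -EFinM -!EFinD; congr EFin; ring.
rewrite integralD//; last exact: integrableD.
rewrite integralD// integralZl// f0 mule0 add0e.
by apply: leeDl; apply: integral_ge0 => x _; rewrite lee_fin sqr_ge0.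
Qed.

End SquareMean.

(** * The topology of the quotient *)

Section Quotient.
Variable F : finFieldType.
Local Notation K := (laurent F).
Local Notation t := (laurent_t F).
Local Notation lop := (@laurent_of_poly F).
Local Notation Y := (PGL2_quot F).
Implicit Types (A B S : GL2 F) (U V : set Y) (y : Y).

Definition GL2_coset A : Y := PGL2_coset (PGL2_class A).

Lemma GL2_coset_surj y : exists A, y = GL2_coset A.
Proof.
exists (repr (repr y)); rewrite /GL2_coset PGL2_reprK.
exact/esym/reprK.
Qed.

Lemma GL2_cosetP A B : GL2_coset A = GL2_coset B <->
  exists (P : 'M[{poly F}]_2) (c : K), [/\ P \in unitmx, c != 0 &
    GL2_mx A = c *: (map_mx lop P *m GL2_mx B)].
Proof.
rewrite /GL2_coset; split=> [/PGL2_cosetP|[P [c [Pu c0 AB]]]].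
  rewrite [X in PGL2_poly X](_ : _ = PGL2_class (A * B^-1)%g); last first.
    by rewrite -PGL2_class_mul -PGL2_class_inv.
  move=> [P [C [Pu CP /PGL2_classP[c c0 e]]]]; exists P, c; split => //.
  rewrite -CP scalemxAl -e /= -mulmxA mulVmx ?mulmx1//; exact: GL2P B.
apply/PGL2_cosetP.
rewrite [X in PGL2_poly X](_ : _ = PGL2_class (A * B^-1)%g); last first.
  by rewrite -PGL2_class_mul -PGL2_class_inv.
exists P, (MkGL2 (map_lop_unit Pu)); split => //.
apply/PGL2_classP; exists c => //=.
by rewrite AB -scalemxAl -mulmxA mulmxV ?mulmx1//; exact: GL2P B.
Qed.

Lemma act_coset A B : PGL2_act (GL2_coset A) (PGL2_class B) = GL2_coset (A * B)%g.
Proof. by rewrite PGL2_actE /GL2_coset -PGL2_class_mul. Qed.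

Lemma act_mul y (g h : PGL2 F) : PGL2_act (PGL2_act y g) h = PGL2_act y (g * h)%g.
Proof.
by have [A ->] := GL2_coset_surj y; rewrite /GL2_coset !PGL2_actE mulgA.
Qed.

Lemma act1 y : PGL2_act y 1%g = y.
Proof. by have [A ->] := GL2_coset_surj y; rewrite /GL2_coset PGL2_actE mulg1. Qed.

(** Congruence modulo t^-a F[[1/t]]. *)
Definition close (a : int) (M N : 'M[K]_2) := forall i j, below (M i j - N i j) a.

Implicit Types (M N P : 'M[K]_2).

Lemma close_le a b M N : a <= b -> close b M N -> close a M N.
Proof. by move=> ab MN i j; apply: below_le (MN i j). Qed.

Lemma closexx a M : close a M M.
Proof. by move=> i j; rewrite subrr. Qed.

Lemma close_sym a M N : close a M N -> close a N M.
Proof. by move=> MN i j; rewrite -opprB; apply: belowN. Qed.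

Lemma close_trans a M N P : close a M N -> close a N P -> close a M P.
Proof. by move=> MN NP i j; rewrite -(subrK (N i j) (M i j)) -addrA; exact: belowD. Qed.

Lemma close_mull a b M N P : (forall i j, below (P i j) a) -> close b M N ->
  close (a + b) (P *m M) (P *m N).
Proof.
move=> Pa MN i j; rewrite !mulmx2E opprD addrACA -!mulrBr.
by apply: belowD; apply: belowM.
Qed.

Lemma close_mulr a b M N P : (forall i j, below (P i j) a) -> close b M N ->
  close (a + b) (M *m P) (N *m P).
Proof.
move=> Pa MN i j; rewrite !mulmx2E opprD addrACA -!mulrBl addrC [a + b]addrC.
by apply: belowD; apply: belowM.
Qed.

(** The four entries can share one modulus.  All the topological arguments
    below go through this description of the neighbourhoods and the resulting
    ones of the open sets of the quotients. *)
Lemma nbhs_GL2 A (W : set (GL2 F)) :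
  nbhs A W <-> exists N : nat, forall B, close N%:Z B A -> W B.
Proof.
split.
  rewrite nbhsE => -[W' [[Ob oOb <-] ObA] W'W].
  have [P PA PO] : nbhs (GL2_mx A) Ob by apply: open_nbhs_nbhs.
  have ex i j : exists N : int, forall g : K,
      (forall n, n < N -> g n = A i j n) -> P i j g.
    by have [N NP] := PA i j; exists N.
  have [f fP] := choice (fun ij : 'I_2 * 'I_2 => ex ij.1 ij.2).
  exists (\max_ij `|f ij|%N)%N => B BA; apply: W'W; apply: PO => i j.
  apply: (fP (i, j)) => n nf; apply/eqP; rewrite -subr_eq0; apply/eqP.
  apply: (BA i j); apply: (lt_le_trans nf).
  by have := leq_bigmax (F := fun ij => `|f ij|%N) (i, j); lia.
move=> [N NW]; pose Ob := [set M : 'M[K]_2 | close N%:Z M A].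
suff : nbhs A (@GL2_mx F @^-1` Ob) by apply: filterS => B; exact: NW.
apply: initial_continuous.
exists (fun i j => [set g : K | below (g - A i j) N%:Z]).
  move=> i j; exists N%:Z => g gA n nN.
  by rewrite lcoefD lcoefN gA// subrr.
by move=> M MA i j; exact: MA.
Qed.

Lemma open_GL2 (W : set (GL2 F)) : open W <->
  forall A, W A -> exists N : nat, forall B, close N%:Z B A -> W B.
Proof.
rewrite openE; split=> [oW A /oW /nbhs_GL2 //|h A WA].
exact/nbhs_GL2/h.
Qed.

Lemma open_PGL2 (W : set (PGL2 F)) : open W <-> forall A, W (PGL2_class A) ->
  exists N : nat, forall B, close N%:Z B A -> W (PGL2_class B).
Proof. by rewrite -[open W]/(open (@PGL2_class F @^-1` W)) open_GL2. Qed.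

Lemma open_quot U : open U <-> forall A, U (GL2_coset A) ->
  exists N : nat, forall B, close N%:Z B A -> U (GL2_coset B).
Proof. by rewrite -[open U]/(open (@PGL2_coset F @^-1` U)) open_PGL2. Qed.

Lemma act_open (g : PGL2 F) U : open U -> open ((@PGL2_act F)^~ g @^-1` U).
Proof.
elim/PGL2_ind: g => G /open_quot oU; apply/open_quot => A.
rewrite /= act_coset => /oU[N NU]; have [M GM] := mx_below_ex G.
exists (M + N)%N => B BA; rewrite act_coset; apply: NU => /=.
rewrite (_ : N%:Z = - M%:Z + (M + N)%N%:Z); last by lia.
exact: close_mulr.
Qed.

(** * Congruence subgroups *)

(** The congruence subgroup K_j of the matrices congruent to 1 modulo t^-j. *)
Definition congr_sub (j : nat) : set (PGL2 F) :=
  [set PGL2_class A | A in [set A : GL2 F | close j%:Z A 1%:M]].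

Definition saturated (j : nat) V :=
  forall y s, V y -> congr_sub j s -> V (PGL2_act y s).

(** If B is close enough to A, with a bound that depends on the size of A^-1,
    then A^-1 B is close to 1, and B = A (A^-1 B) is a translate of A by K_j. *)
Lemma saturated_open j V : saturated j V -> open V.
Proof.
move=> Vj; apply/open_quot => A VA; have [M AM] := mx_below_ex (A^-1)%g.
exists (M + j)%N => B BA.
have -> : B = (A * (A^-1 * B))%g by rewrite mulgA mulgV mul1g.
rewrite -act_coset; apply: Vj => //; exists (A^-1 * B)%g => //=.
rewrite -(mulVmx (GL2P A)) (_ : j%:Z = - M%:Z + (M + j)%N%:Z); last by lia.
exact: close_mull.
Qed.

Lemma congr_sub_le i j : (i <= j)%N -> congr_sub j `<=` congr_sub i.
Proof. by move=> ij _ [A Aj <-]; exists A => //; apply: close_le Aj; lia. Qed.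

Lemma congr_sub1 j : congr_sub j 1%g.
Proof. by exists 1%g => //; exact: closexx. Qed.

Lemma open_congr_sub U y : open U -> U y ->
  exists j, forall s, congr_sub j s -> U (PGL2_act y s).
Proof.
have [A ->] := GL2_coset_surj y => /open_quot oU /oU[N NU].
have [M AM] := mx_below_ex A.
exists (M + N)%N => _ [S S1 <-]; rewrite act_coset; apply: NU => /=.
rewrite -[X in close _ _ X]mulmx1 (_ : N%:Z = - M%:Z + (M + N)%N%:Z); last by lia.
exact: close_mull.
Qed.

Lemma close1_GL2O (M : 'M[K]_2) j : (0 < j)%N -> close j%:Z M 1%:M -> GL2O M.
Proof.
move=> j0 M1; have M0 i k : below (M i k) 0.
  rewrite -(subrK (1%:M i k) (M i k)); apply: belowD.
    by apply: below_le (M1 i k); lia.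
  by rewrite mxE; case: (i == k); [exact: (@belowC _ 1)|].
split=> //; rewrite (GL2O_det M0).2.
have coef i k : M i k 0 = (1%:M i k : K) 0.
  by rewrite -(subrK (1%:M i k) (M i k)) lcoefD (M1 i k 0) ?add0r//; lia.
by rewrite !coef !mxE /= mul1r mul0r subr0 oner_eq0.
Qed.

Lemma congr_subM j : (0 < j)%N -> forall g h, congr_sub j g -> congr_sub j h ->
  congr_sub j (g * h)%g.
Proof.
move=> j0 _ _ [A Aj <-] [B Bj <-]; exists (A * B)%g; last by rewrite -PGL2_class_mul.
have [A0 _] := close1_GL2O j0 Aj.
apply: close_trans Aj => /=; rewrite -[X in close _ _ X]mulmx1 -[j%:Z]add0r.
exact: close_mull.
Qed.

Lemma congr_subV j : (0 < j)%N -> forall g, congr_sub j g -> congr_sub j g^-1%g.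
Proof.
move=> j0 _ [A Aj <-]; exists (A^-1)%g; last by rewrite -PGL2_class_inv.
have [A0 _] := GL2O_inv (close1_GL2O j0 Aj).
rewrite /= -[X in close _ X _]mulmx1 -[X in close _ _ X](mulVmx (GL2P A)) -[j%:Z]add0r.
by apply: close_mull => //; exact: close_sym.
Qed.

(** The entries of the matrix 1 + sum_n x_n t^(-n-1). *)
Definition congr_coef (x : nat -> 'M[F]_2) (i j : 'I_2) (n : int) : F :=
  if n is Posz k.+1 then x k i j else ((n == 0) && (i == j))%:R.

Lemma congr_coef_laurent x i j : congr_coef x i j \in @laurent_pred F.
Proof. by apply/asboolP; exists 0 => -[]. Qed.

Definition congr_mx (x : nat -> 'M[F]_2) : 'M[K]_2 :=
  \matrix_(i, j) Laurent (congr_coef_laurent x i j).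

Lemma coef1mx (i j : 'I_2) n : (1%:M i j : K) n = ((n == 0) && (i == j))%:R.
Proof. by rewrite mxE; case: (i == j); rewrite ?andbT ?andbF// lcoef1. Qed.

Lemma congr_mx_close1 x : close 1 (congr_mx x) 1%:M.
Proof.
move=> i j n n1; rewrite lcoefD lcoefN coef1mx mxE.
by case: n n1 => [[|n]|n]//= _; rewrite subrr.
Qed.

Lemma congr_mx_unit x : congr_mx x \in unitmx.
Proof. exact: GL2O_unit (@close1_GL2O _ 1 isT (congr_mx_close1 x)). Qed.

Definition congr_elt (x : nat -> 'M[F]_2) : GL2 F := MkGL2 (congr_mx_unit x).

Definition congr_dig (M : 'M[K]_2) (n : nat) : 'M[F]_2 := \matrix_(i, j) M i j n.+1%:Z.

Lemma congr_mx_dig (M : 'M[K]_2) : close 1 M 1%:M -> M = congr_mx (congr_dig M).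
Proof.
move=> M1; apply/matrixP => i j; apply: laurent_ext => n; rewrite mxE /=.
have M1n : n < 1 -> M i j n = ((n == 0) && (i == j))%:R.
  move=> n1; have := M1 i j n n1; rewrite lcoefD lcoefN => /eqP.
  by rewrite subr_eq0 => /eqP ->; rewrite coef1mx.
by case: n M1n => [[|n]|n] M1n; [exact: M1n|rewrite /= mxE|exact: M1n].
Qed.

Lemma congr_mx_closeP (N : nat) x x' : close N.+1%:Z (congr_mx x) (congr_mx x') <->
  forall n, (n < N)%N -> x n = x' n.
Proof.
split=> [xx' n nN|xx' i j n nN].
  apply/matrixP => i j; have /(_ _)/eqP := xx' i j n.+1%:Z.
  rewrite lcoefD lcoefN !mxE /= subr_eq0 => h; apply/eqP/h.
  by lia.
rewrite lcoefD lcoefN !mxE /=; case: n nN => [[|n]|n] nN /=; rewrite ?subrr//.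
by rewrite xx' ?subrr//; lia.
Qed.

(** The expansion in powers of 1/t makes K_1 a continuous image of the product
    of countably many copies of the finite set M_2(F). *)
Lemma congr_sub_compact : compact (congr_sub 1).
Proof.
pose T := fun _ : nat => discrete_topology 'M[F]_2 : topologicalType.
have cT : compact [set f : prod_topology T | forall n, [set: T n] (f n)].
  apply: (@tychonoff _ T (fun n => [set: T n])) => n; apply: finite_compact.
  exact: (@finite_finset _ [set: 'M[F]_2]).
pose Phi (x : prod_topology T) := PGL2_class (congr_elt x).
have -> : congr_sub 1 = Phi @` [set f | forall n, [set: T n] (f n)].
  apply/seteqP; split=> [_ [A A1 <-]|_ [x _ <-]].
    exists (congr_dig A) => //; congr PGL2_class; apply: val_inj.
    exact/esym/congr_mx_dig.
  by exists (congr_elt x) => //; exact: congr_mx_close1.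
apply: continuous_compact cT; apply: continuous_subspaceT => x W.
rewrite nbhsE => -[W' [oW Wx] W'W].
have [N NO] := (open_PGL2 W').1 oW _ Wx.
have xN : nbhs x [set x' : prod_topology T | forall n, (n < N)%N -> x n = x' n].
  elim: N {NO} => [|N IH]; first by apply: filterS filterT => x' _.
  have xN : nbhs x (@proj _ T N @^-1` [set x N]).
    by apply: proj_continuous; exact: discrete_set1.
  apply: filterS (filterI IH xN) => x' [hx hN] n.
  by rewrite ltnS leq_eqVlt => /predU1P[->|/hx//]; exact/esym.
apply: filterS xN => x' xx'; apply: W'W; apply: NO => /=.
apply/close_sym/(close_le _ ((congr_mx_closeP N x x').2 xx')); lia.
Qed.

(** Expansions truncated after j digits.  They represent K_1 modulo K_(j+1),
    hence a fortiori, each coset being repeated the same number of times,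
    modulo K_j. *)
Definition congr_rep (j : nat) (x : {ffun 'I_j -> 'M[F]_2}) : GL2 F :=
  congr_elt (fun n => if insub n is Some i then x i else 0).

Lemma congr_rep_close1 j x : close 1 (@congr_rep j x) 1%:M.
Proof. exact: congr_mx_close1. Qed.

Lemma congr_rep_perm j (k : GL2 F) : close 1 k 1%:M ->
  exists2 sigma : {ffun 'I_j -> 'M[F]_2} -> {ffun 'I_j -> 'M[F]_2},
    injective sigma & forall x, exists2 s, congr_sub j s &
      PGL2_class (k * congr_rep x)%g = (PGL2_class (congr_rep (sigma x)) * s)%g.
Proof.
move=> k1; have Ok := @close1_GL2O _ 1 isT k1; have [k0 _] := Ok.
have kr1 x : close 1 (GL2_mx k *m @congr_rep j x) 1%:M.
  apply: close_trans k1 => /=; rewrite -[X in close _ _ X]mulmx1 -[1]add0r.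
  by apply: close_mull => //; exact: congr_rep_close1.
pose sigma (x : {ffun 'I_j -> 'M[F]_2}) :=
  [ffun i : 'I_j => congr_dig (GL2_mx k *m congr_rep x) i].
have sigmaP x : close j.+1%:Z (GL2_mx k *m congr_rep x) (congr_rep (sigma x)).
  rewrite [X in close _ X _]congr_mx_dig//; apply/congr_mx_closeP => n nj.
  by rewrite insubT ffunE.
exists sigma => [x x' xx'|x].
  have : close j.+1%:Z (congr_rep x) (congr_rep x').
    have kk x0 : GL2_mx (congr_rep x0) = invmx k *m (GL2_mx k *m @congr_rep j x0).
      by rewrite mulKmx//; exact: GL2P.
    rewrite (kk x) (kk x') -[_%:Z]add0r; apply: close_mull.
      exact: (GL2O_inv Ok).1.
    apply: close_trans (sigmaP x) _; rewrite xx'; exact/close_sym/sigmaP.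
  move/congr_mx_closeP => h; apply/ffunP => i.
  by have := h i (ltn_ord i); rewrite valK.
have Or := @close1_GL2O _ 1 isT (congr_rep_close1 (sigma x)).
exists (PGL2_class ((congr_rep (sigma x))^-1 * (k * congr_rep x))%g).
  eexists; last by reflexivity.
  rewrite /= -(mulVmx (GL2P (congr_rep (sigma x)))) -[_%:Z]add0r.
  apply: close_mull; first exact: (GL2O_inv Or).1.
  by apply: close_le (sigmaP x); lia.
by rewrite -[RHS]/(PGL2_mul _ _) PGL2_class_mul mulgA mulgV mul1g.
Qed.

(** Translation by an element of K_1 permutes the cosets of K_(j+1) in K_1, so
    the average over representatives is K_1-invariant. *)
Lemma congr_average (R : numFieldType) j (g : Y -> R) :
    (forall y s, congr_sub j s -> g (PGL2_act y s) = g y) ->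
  forall y s, congr_sub 1 s ->
  \sum_(x : {ffun 'I_j -> 'M[F]_2}) g (PGL2_act (PGL2_act y s) (PGL2_class (congr_rep x))) =
  \sum_(x : {ffun 'I_j -> 'M[F]_2}) g (PGL2_act y (PGL2_class (congr_rep x))).
Proof.
move=> gj y _ [k k1 <-]; have [sigma sinj sP] := @congr_rep_perm j _ k1.
rewrite [RHS](reindex sigma); last exact/onW_bij/injF_bij.
apply: eq_bigr => x _; have [s sj e] := sP x.
by rewrite act_mul -[(_ * _)%g]/(PGL2_mul _ _) PGL2_class_mul e -act_mul gj.
Qed.

(** * The level function *)

Lemma coset_level y : exists n, forall A, y = GL2_coset A -> level (GL2_mx A) n.
Proof.
have [A ->] := GL2_coset_surj y; have [n An] := level_ex (GL2P A).
exists n => B /GL2_cosetP[P [c [Pu c0 AB]]].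
apply: (level_mull Pu); apply: (@level_scaleV _ c) => //.
by rewrite -AB.
Qed.

Definition lev y : nat := projT1 (cid (coset_level y)).

Lemma lev_level A : level (GL2_mx A) (lev (GL2_coset A)).
Proof. by rewrite /lev; case: cid => n /= h; exact: h. Qed.

Lemma lev_eq A n : level (GL2_mx A) n -> lev (GL2_coset A) = n.
Proof. exact/level_uniq/lev_level. Qed.

Lemma lev_congr y s : congr_sub 1 s -> lev (PGL2_act y s) = lev y.
Proof.
have [A -> [S S1 <-]] := GL2_coset_surj y; rewrite act_coset.
apply: lev_eq; apply: level_mulr (lev_level A) _.
exact: (@close1_GL2O _ 1).
Qed.

(** A matrix of GL_2(F[[1/t]]) is the product of its constant term, which is
    absorbed on the left by GL_2(F), and of an element of K_1. *)
Lemma lev0 y : lev y = 0%N ->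
  exists2 s, congr_sub 1 s & y = PGL2_act (GL2_coset 1%g) s.
Proof.
have [A -> lA] := GL2_coset_surj y; have := lev_level A; rewrite lA.
move=> [P [c [B [Pu c0 OB e]]]]; have [B0 detB] := OB.
pose C : 'M[F]_2 := \matrix_(i, j) B i j 0.
have Cu : C \in unitmx.
  by rewrite unitmxE unitfE; move: detB; rewrite (GL2O_det B0).2 mx2_det !mxE.
have OC := GL2O_const (etrans (unitmx_inv C) Cu).
pose Q := map_mx polyC (invmx C).
have Qu : Q \in unitmx.
  by rewrite unitmxE det_map_mx; apply: rmorph_unit; rewrite -unitmxE unitmx_inv.
have QE : map_mx lop Q = map_mx (@laurentC F) (invmx C).
  by apply/matrixP => i j; rewrite !mxE lopC.
have M1 : close 1 (map_mx lop Q *m B) 1%:M.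
  rewrite (_ : 1%:M = map_mx lop Q *m map_mx (@laurentC F) C); last first.
    by rewrite QE -map_mxM mulVmx// map_mx1.
  rewrite QE -[X in close X]add0r; apply: close_mull; first exact: OC.1.
  move=> i j n n1; rewrite lcoefD lcoefN !mxE /=.
  by have [->|n0] := eqVneq n 0; [rewrite subrr|rewrite subr0 B0//; lia].
exists (PGL2_class (MkGL2 (GL2O_unit (@close1_GL2O _ 1 isT M1)))).
  by eexists; last by reflexivity.
rewrite act_coset mul1g; apply/esym/GL2_cosetP.
exists (Q *m P), c^-1; split; rewrite ?unitmx_mul ?Qu ?invr_eq0//=.
rewrite map_lopM -mulmxA e /dmx expr0 -one_mx2 mul1mx -scalemxAr scalerA.
by rewrite mulVf// scale1r.
Qed.

(** * The three steps *)

Definition GL2_diag : GL2 F.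
Proof.
exists (mx2 t 0 0 1).
by rewrite unitmxE det_mx2 mulr1 mul0r subr0 unitfE laurent_t_neq0.
Defined.

Definition GL2_const (C : 'M[F]_2) (Cu : C \in unitmx) : GL2 F :=
  MkGL2 (GL2O_unit (GL2O_const Cu)).

(** The vector (r1, r2) consists of the constant terms of the first row of the
    factor in GL_2(F[[1/t]]) of a representative of y: multiplied by C, it has a
    non-zero first coordinate, and [level_down] applies. *)
Lemma lev_down y : (0 < lev y)%N -> exists r1 r2 : F, (r1 != 0) || (r2 != 0) /\
  forall (C D : 'M[F]_2) (Cu : C \in unitmx) (Du : D \in unitmx),
    r1 * C 0 0 + r2 * C 1 0 != 0 ->
  (lev (PGL2_act y (PGL2_class (GL2_const Cu * GL2_diag * GL2_const Du)%g)) < lev y)%N.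
Proof.
have [A ->] := GL2_coset_surj y; have := lev_level A.
case: (lev _) => // n [P [c [B [Pu c0 OB e]]]] _; have [B0 detB] := OB.
exists (B 0 0 0), (B 0 1 0); split.
  rewrite -negb_and; apply: contra detB => /andP[/eqP b00 /eqP b01].
  by rewrite (GL2O_det B0).2 b00 b01 !mul0r subrr.
move=> C D Cu Du rC; rewrite act_coset ltnS (_ : lev _ = n)//.
apply: lev_eq => /=; rewrite !mulmxA; apply: level_mulr (GL2O_const Du).
pose C' := map_mx (@laurentC F) C.
apply: (@level_down _ P c _ (B *m C')) => //.
- exact/GL2O_mul/GL2O_const.
- by rewrite mulmxA e -scalemxAl mulmxA.
rewrite mulmx2E !mxE lcoefD !lead_mul0//; exact: belowC.
Qed.

(** The first columns are e1, e2, e1 + e2 and the second ones e2, e1 + e2, e1: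
    three pairwise independent vectors in both cases.  The first columns matter
    for the steps, the second ones for their inverses. *)
Definition frame (i : 'I_3) : 'M[F]_2 :=
  if i == 0 then mx2 1 0 0 1 else if i == 1 then mx2 0 1 1 1 else mx2 1 1 1 0.

Lemma frame_unit i : frame i \in unitmx.
Proof.
rewrite unitmxE unitfE /frame; do 2?case: ifP => _; rewrite det_mx2.
all: by rewrite !(mulr1, mulr0, mul0r, subr0, sub0r) ?oppr_eq0 oner_eq0.
Qed.

Lemma frameV_unit i : invmx (frame i) \in unitmx.
Proof. by rewrite unitmx_inv frame_unit. Qed.

Definition swap : 'M[F]_2 := mx2 0 1 1 0.

Lemma swap_unit : swap \in unitmx.
Proof. by rewrite unitmxE unitfE det_mx2 !(mulr1, mul0r, sub0r) oppr_eq0 oner_eq0. Qed.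

Lemma frame_swap_unit i : frame i *m swap \in unitmx.
Proof. by rewrite unitmx_mul frame_unit swap_unit. Qed.

Lemma swap_frameV_unit i : swap *m invmx (frame i) \in unitmx.
Proof. by rewrite unitmx_mul frameV_unit swap_unit. Qed.

Definition step (i : 'I_3) : PGL2 F :=
  PGL2_class (GL2_const (frame_unit i) * GL2_diag * GL2_const (frameV_unit i))%g.

(** Up to a scalar, diag(t, 1)^-1 is the conjugate of diag(t, 1) by the matrix
    that exchanges the coordinates. *)
Lemma stepV i : (step i)^-1%g = PGL2_class
  (GL2_const (frame_swap_unit i) * GL2_diag * GL2_const (swap_frameV_unit i))%g.
Proof.
apply: (mulgI (step i)); rewrite mulgV -[RHS]/(PGL2_mul _ _) PGL2_class_mul.
apply/esym/PGL2_classP; exists t; first exact: laurent_t_neq0.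
rewrite /= !map_mxM /= !mulmxA -!(mulmxA _ _ (map_mx _ (frame i))).
rewrite -map_mxM mulVmx ?frame_unit// map_mx1 mulmx1.
have e : mx2 t 0 0 1 *m map_mx (@laurentC F) swap *m mx2 t 0 0 1 *m
    map_mx (@laurentC F) swap = t%:M.
  rewrite map_mx2 raddf0 rmorph1 !mul_mx2 -[t%:M]scalemx1 one_mx2 scale_mx2.
  by congr mx2; ring.
rewrite -!mulmxA [X in _ *m X](_ : _ = t%:M *m map_mx (@laurentC F) (invmx (frame i))).
  rewrite mul_scalar_mx -scalemxAr -map_mxM mulmxV ?frame_unit//.
  by rewrite map_mx1.
by rewrite -e !mulmxA.
Qed.

Lemma two_of_three (r1 r2 : F) : (r1 != 0) || (r2 != 0) ->
  (2 <= (r1 != 0)%R + (r2 != 0)%R + (r1 + r2 != 0)%R)%N.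
Proof.
have [->|r10] := eqVneq r1 0; first by rewrite add0r => /= ->.
have [->|r20] := eqVneq r2 0; first by rewrite addr0 r10.
by [].
Qed.

(** A non-zero vector of F^2 is orthogonal to at most one of three pairwise
    independent vectors. *)
Lemma steps_down y : (0 < lev y)%N ->
  (2 <= \sum_(i < 3) (lev (PGL2_act y (step i)) < lev y))%N /\
  (2 <= \sum_(i < 3) (lev (PGL2_act y (step i)^-1%g) < lev y))%N.
Proof.
move=> /lev_down[r1 [r2 [/two_of_three r12 down]]].
rewrite !big_ord_recl !big_ord0 !addn0 !addnA.
have implyN (b c : bool) : (b -> c) -> (b <= c)%N by case: b c => [] [] // ->.
have r21 : (2 <= (r2 != 0)%R + (r1 + r2 != 0)%R + (r1 != 0)%R)%N.
  by rewrite addnC addnA.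
split; [apply: (leq_trans r12)|apply: (leq_trans r21)].
  by apply: leq_add; [apply: leq_add|]; apply: implyN => r;
    apply: down; rewrite !mxE /= !(mulr0, mulr1, addr0, add0r).
by apply: leq_add; [apply: leq_add|]; apply: implyN => r; rewrite stepV;
  apply: down; rewrite !mulmx2E !mxE /= !(mulr0, mulr1, addr0, add0r).
Qed.

Lemma count_up (n : nat) (f : 'I_3 -> nat) :
  ((0 < n)%N -> (2 <= \sum_(i < 3) (f i < n))%N) ->
  (\sum_(i < 3) (n < f i) <= (0 < n) + 3 * (n == 0))%N.
Proof.
rewrite !big_ord_recl !big_ord0 !addn0.
move: (f _) (f _) (f _) => a b c; case: n => [_|n /(_ isT)] /=.
  by case: (0 < a)%N; case: (0 < b)%N; case: (0 < c)%N.
by case: (ltngtP a n.+1); case: (ltngtP b n.+1); case: (ltngtP c n.+1).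
Qed.

Lemma steps_up y : (\sum_(i < 3) (lev y < lev (PGL2_act y (step i)^-1%g)) <=
  (0 < lev y) + 3 * (lev y == 0))%N.
Proof. by apply: count_up => /steps_down[]. Qed.

End Quotient.

(** * The spectral gap *)

Section Gap.
Context {R : realType} {F : finFieldType}.
Local Notation Y := (PGL2_borel F).
Variable m : probability Y R.
Hypothesis mpres : measure_preserving m (@PGL2_act F).
Implicit Types (f g u : Y -> R) (e D : R).

Local Notation act := (@PGL2_act F).
Local Notation sqI := (sqint m).

Lemma act_measurable (g : PGL2 F) :
  measurable_fun setT (fun y : Y => act y g : Y).
Proof.
apply: (@measurability _ _ Y Y setT (fun y => act y g) (@open (PGL2_quot F))) => //.
move=> _ [U oU <-]; rewrite setTI.
by apply: sub_sigma_algebra; exact: act_open.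
Qed.

Lemma integral_act (g : PGL2 F) (h : Y -> \bar R) : measurable_fun setT h ->
  (forall y, 0 <= h y)%E -> (\int[m]_y h (act y g) = \int[m]_y h y)%E.
Proof.
move=> mh h0; have mg := act_measurable g.
have := ge0_integral_pushforward mg m measurableT mh (fun y _ => h0 y).
rewrite preimage_setT => <-.
by apply: eq_measure_integral => A mA _; exact: mpres.
Qed.

Lemma sqint_act (g : PGL2 F) f : measurable_fun setT f ->
  sqI (fun y => f (act y g)) = sqI f.
Proof.
move=> mf; apply: (integral_act g (sq_measurable mf)) => y.
by rewrite lee_fin sqr_ge0.
Qed.

Definition congr_inv (j : nat) (T : Type) (g : Y -> T) :=
  forall y s, congr_sub j s -> g (act y s) = g y.

(** The preimage of a set is saturated, hence open. *)
Lemma congr_inv_measurable j g : congr_inv j g -> measurable_fun setT g.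
Proof.
move=> gj _ B mB; rewrite setTI; apply: sub_sigma_algebra.
by apply: (@saturated_open _ j) => y s /= gy sj; rewrite gj.
Qed.

Lemma saturated_measurable j (V : set Y) : saturated j V -> measurable V.
Proof. by move=> Vj; apply: sub_sigma_algebra; exact: saturated_open Vj. Qed.

Definition loc_const : set (Y -> R) := [set g | exists j, congr_inv j g].

Lemma loc_const_measurable g : loc_const g -> measurable_fun setT g.
Proof. by case=> j; exact: congr_inv_measurable. Qed.

Lemma loc_constD f g : loc_const f -> loc_const g -> loc_const (fun y => f y + g y).
Proof.
move=> [i fi] [j gj]; exists (maxn i j) => y s sij; congr (_ + _).
  by apply: fi; apply: congr_sub_le sij; exact: leq_maxl.
by apply: gj; apply: congr_sub_le sij; exact: leq_maxr.
Qed.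

Lemma loc_constZ c f : loc_const f -> loc_const (fun y => c * f y).
Proof. by case=> i fi; exists i => y s si; rewrite fi. Qed.

Lemma loc_const1 : loc_const (cst 1). Proof. by exists 0%N. Qed.

(** The sets V n of the points whose K_(n+1)-orbit lies in U increase to U, and
    their indicators are invariant under K_(n+1). *)
Lemma approx_open (U : set Y) : open (U : set (PGL2_quot F)) ->
  sq_approx m loc_const \1_U.
Proof.
move=> oU; pose V n := [set y : Y | forall s, congr_sub n.+1 s -> U (act y s)].
have Vsat n : saturated n.+1 (V n).
  by move=> y s Vy sn s' sn'; rewrite act_mul; apply: Vy; exact: congr_subM.
have -> : U = \bigcup_n V n.
  apply/seteqP; split=> [y Uy|y [n _ Vy]].
    have [j jU] := open_congr_sub oU Uy.
    by exists j => // s /(congr_sub_le (leqnSn j)); exact: jU.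
  by rewrite -(act1 y); apply: Vy; exact: congr_sub1.
apply: approx_bigcup.
- exact: loc_const_measurable.
- move=> i j ij; apply/subsetPset => y Vy s /congr_sub_le sj; apply/Vy/sj.
  by rewrite ltnS.
- by move=> n; apply: saturated_measurable (Vsat n).
- move=> n; apply: approx_self; first exact: loc_const_measurable.
  exists n.+1 => y s sn; rewrite !indicE; congr (_%:R).
  have [yV|yV] := pselect (V n y).
    by rewrite !mem_set//; exact: Vsat.
  rewrite !memNset// => Vys; apply: yV => s' sn'.
  have [t tn st] : exists2 t, congr_sub n.+1 t & (s * t = s')%g.
    exists (s^-1 * s')%g; last by rewrite mulgA mulgV mul1g.
    by apply: congr_subM => //; apply: congr_subV.
  by rewrite -st -act_mul; apply: Vys.
Qed.

Lemma approx_loc_const f : measurable_fun setT f -> (sqI f < +oo)%E ->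
  sq_approx m loc_const f.
Proof.
apply: (@approx_sqint _ _ _ m loc_const _ _ _ _ (@open (PGL2_quot F))).
- exact: loc_const_measurable.
- exact: loc_const1.
- exact: loc_constD.
- exact: loc_constZ.
- by move=> A B; exact: openI.
- by [].
- by move=> A; exact: sub_sigma_algebra.
- exact: approx_open.
Qed.

Lemma lev_measurable (P : nat -> Prop) : measurable [set y : Y | P (lev y)].
Proof.
apply: (@saturated_measurable 1) => y s Py s1; rewrite /= lev_congr//.
Qed.

Lemma indicM_measurable (A : set Y) f : measurable A -> measurable_fun setT f ->
  measurable_fun setT (fun y => \1_A y * f y).
Proof. by move=> mA mf; apply: measurable_funM => //; exact: measurable_indic. Qed.

(** Level 0 is a single orbit of K_1, so a K_1-invariant function is constant
    there; it is enough to compare f with such a function. *)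
Lemma base_level f e D : measurable_fun setT f -> (sqI f < +oo)%E -> 0 < e ->
    (forall s, congr_sub 1 s -> (sqI (fun y => (f (act y s) - f y)%R) <= D%:E)%E) ->
  exists c, (sqI (fun y => (\1_[set y | lev y = 0%N] y * (f y - c))%R) <=
    (2 * D + 2 * e)%:E)%E.
Proof.
(* the constant is the value on level 0 of the average g0 of a K_j-invariant
   approximation g *)
move=> mf foo e0 fD; have [_ /(_ e e0)[g [j gj] fg]] := approx_loc_const mf foo.
have mg := congr_inv_measurable gj.
pose X : finType := {ffun 'I_j -> 'M[F]_2}.
have X0 : (0 < #|X|)%N by apply/card_gt0P; exists [ffun=> 0].
pose r (x : X) := PGL2_class (congr_rep x).
pose g0 (y : Y) : R := #|X|%:R^-1 * \sum_(x : X) g (act y (r x)).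
have g0P y s : congr_sub 1 s -> g0 (act y s) = g0 y.
  by move=> s1; congr (_ * _); exact: congr_average.
pose y0 : Y := GL2_coset 1%g.
exists (g0 y0).
have mg0 : measurable_fun setT g0 := congr_inv_measurable g0P.
apply: (@le_trans _ _ (sqI (fun y => f y - g0 y))).
  apply: sqint_le.
  - apply: indicM_measurable; first exact: (lev_measurable (fun n => n = 0%N)).
    exact: measurable_funB.
  - exact: measurable_funB.
  move=> y; rewrite indicE; have [y1|y1] := pselect (lev y = 0%N).
    rewrite mem_set// mul1r; have [s s1 ->] := lev0 y1.
    by rewrite (g0P _ _ s1).
  by rewrite memNset// mul0r expr0n sqr_ge0.
have mfa s : measurable_fun setT (fun y : Y => f (act y s)).
  exact: measurableT_comp mf (act_measurable s).
have mga s : measurable_fun setT (fun y : Y => g (act y s)).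
  exact: measurableT_comp mg (act_measurable s).
rewrite (@sqint_eq _ _ _ m _ (fun y => #|X|%:R^-1 *
    \sum_(x : X) ((f y - f (act y (r x))) + (f (act y (r x)) - g (act y (r x)))))).
  apply: sqint_avg => // x.
    by apply: measurable_funD; apply: measurable_funB.
  apply: sqint_add; [exact: measurable_funB|exact: measurable_funB| |].
    rewrite (@sqint_eq _ _ _ m _ (fun y => -1 * (f (act y (r x)) - f y))); last first.
      by move=> y; ring.
    have rx : congr_sub 1 (r x) by exists (congr_rep x) => //; exact: congr_rep_close1.
    apply: le_trans (sqint_scale (-1) _ (fD _ rx)) _; first exact: measurable_funB.
    by rewrite sqrrN expr1n mul1r.
  rewrite (sqint_act (r x) (f := fun y => f y - g y))//.
  exact: measurable_funB.
move=> y; under eq_bigr do rewrite addrA subrK.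
rewrite sumrB sumr_const (_ : #|xpredT| = #|X|); last exact: eq_card.
rewrite -[f y *+ _]mulr_natl mulrBr mulrA mulVf ?mul1r//.
by rewrite pnatr_eq0 -lt0n.
Qed.

(** The set P i contains the points that s_i moves down, P' i their images by
    s_i.  A point of positive level is in at least two of the P i, but in at
    most one of the P' i; the factor 3/2 lost in the comparison of u(y) with
    u(y s_i) leaves the balance 2 a1 <= 3/2 (a1 + 3 a0) + 9 D. *)
Lemma cusp_level u D : measurable_fun setT u -> (sqI u < +oo)%E ->
    (forall i, (sqI (fun y => (u (act y (step F i)) - u y)%R) <= D%:E)%E) ->
  (sqI (fun y => (\1_[set y | (0 < lev y)%N] y * u y)%R) <=
   9%:E * sqI (fun y => (\1_[set y | lev y = 0%N] y * u y)%R) + (18 * D)%:E)%E.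
Proof.
move=> mu uoo uD.
pose J (A : set Y) := sqI (fun y => \1_A y * u y).
pose s i := step F i.
pose P i := [set y : Y | (lev (act y (s i)) < lev y)%N].
pose P' i := [set y : Y | (lev y < lev (act y (s i)^-1%g))%N].
have levm (g : PGL2 F) n : measurable [set y : Y | lev (act y g) = n].
  rewrite -[X in measurable X]setTI.
  exact: (act_measurable g measurableT (lev_measurable (fun k => k = n))).
have mlt (g h : PGL2 F) : measurable [set y : Y | (lev (act y g) < lev (act y h))%N].
  rewrite [X in measurable X](_ : _ = \bigcup_n \bigcup_k
     ([set y : Y | lev (act y g) = n] `&` [set y : Y | lev (act y h) = (n + k).+1])).
    do 2 (apply: bigcupT_measurable => ?); exact: measurableI.
  apply/seteqP; split=> [y /= gh|y [n _ [k _ [/= -> ->]]]]; last by lia.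
  exists (lev (act y g)) => //; exists (lev (act y h) - (lev (act y g)).+1)%N => //.
  by split => //=; lia.
have mP i : measurable (P i) by have := mlt (s i) 1%g; under eq_set do rewrite act1.
have mP' i : measurable (P' i) by have := mlt 1%g (s i)^-1%g; under eq_set do rewrite act1.
have mpos : measurable [set y : Y | (0 < lev y)%N] := lev_measurable (fun n => (0 < n)%N).
have mzero : measurable [set y : Y | lev y = 0%N] := lev_measurable (fun n => n = 0%N).
have Jfin A : measurable A -> J A \is a fin_num.
  move=> mA; rewrite ge0_fin_numE ?sqint_ge0//; apply: le_lt_trans uoo.
  apply: sqint_le => //; first exact: indicM_measurable.
  move=> y; rewrite indicE; case: (_ \in _); rewrite ?mul1r// mul0r expr0n.
  exact: sqr_ge0.
have mJ A : measurable A -> measurable_fun setT (fun y => \1_A y * u y).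
  by move=> mA; exact: indicM_measurable.
have Jsum (A : 'I_3 -> set Y) : (forall i, measurable (A i)) ->
    (\sum_(i < 3) J (A i) = \int[m]_y (\sum_(i < 3) (\1_(A i) y * u y) ^+ 2)%:E)%E.
  move=> mA; rewrite -ge0_integral_sum//.
  - by apply: eq_integral => y _; rewrite sumEFin.
  - by move=> i; apply: sq_measurable; exact: mJ.
  - by move=> i y _; rewrite lee_fin sqr_ge0.
have mSum (A : 'I_3 -> set Y) : (forall i, measurable (A i)) ->
    measurable_fun setT (fun y => (\sum_(i < 3) (\1_(A i) y * u y) ^+ 2)%:E).
  move=> mA; apply/measurable_EFinP; apply: measurable_sum => i.
  by apply: measurable_funX; exact: mJ.
have sumE (A : 'I_3 -> set Y) (b : 'I_3 -> bool) y : (forall i, A i y <-> b i) ->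
    \sum_(i < 3) (\1_(A i) y * u y) ^+ 2 = (\sum_(i < 3) b i)%N%:R * u y ^+ 2.
  move=> Ab; rewrite natr_sum mulr_suml; apply: eq_bigr => i _.
  rewrite indicE; case: (b i) (Ab i) => bi.
    by rewrite mem_set ?mul1r//; apply/bi.
  by rewrite memNset ?mul0r ?expr0n// => /bi.
have indE (b : Y -> bool) y : (\1_[set y | b y] y * u y) ^+ 2 = (b y)%:R * u y ^+ 2.
  rewrite indicE; case: (boolP (b y)) => by_; first by rewrite mem_set ?mul1r.
  by rewrite memNset ?mul0r ?expr0n//; exact/negP.
(* every point of positive level lies in at least two of the P i *)
have down : (2%:E * J [set y | (0 < lev y)%N] <= \sum_(i < 3) J (P i))%E.
  rewrite Jsum// -ge0_integralZl_EFin//; last 2 first.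
  - by move=> y _; rewrite lee_fin sqr_ge0.
  - by apply: sq_measurable; exact: mJ.
  apply: ge0_le_integral => //.
  - by move=> y _; rewrite -EFinM lee_fin mulr_ge0// sqr_ge0.
  - under eq_fun do rewrite -EFinM; apply/measurable_EFinP.
    by apply: measurable_funM => //; apply: measurable_funX; exact: mJ.
  - exact: mSum.
  move=> y _; rewrite -EFinM lee_fin indE.
  rewrite (sumE P (fun i => (lev (act y (s i)) < lev y)%N))// mulrA.
  apply: ler_wpM2r; first exact: sqr_ge0.
  case: (posnP (lev y)) => [_|/steps_down[h _]]; first by rewrite mulr0 ler0n.
  by rewrite mulr1 ler_nat.
(* a point lies in at most one of the P' i if its level is positive, and in
   at most three of them anyway *)
have up : (\sum_(i < 3) J (P' i) <=
    J [set y | (0 < lev y)%N] + 3%:E * J [set y | lev y = 0%N])%E.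
  rewrite Jsum// -ge0_integralZl_EFin//; last 2 first.
  - by move=> y _; rewrite lee_fin sqr_ge0.
  - by apply: sq_measurable; exact: mJ.
  rewrite -ge0_integralD//; last 4 first.
  - by move=> y _; rewrite lee_fin sqr_ge0.
  - by apply: sq_measurable; exact: mJ.
  - by move=> y _; rewrite -EFinM lee_fin mulr_ge0// sqr_ge0.
  - under eq_fun do rewrite -EFinM; apply/measurable_EFinP.
    by apply: measurable_funM => //; apply: measurable_funX; exact: mJ.
  apply: ge0_le_integral => //.
  - by move=> y _; rewrite lee_fin; apply: sumr_ge0 => i _; exact: sqr_ge0.
  - exact: mSum.
  - under eq_fun do rewrite -EFinM -EFinD; apply/measurable_EFinP.
    apply: measurable_funD; first by apply: measurable_funX; exact: mJ.
    by apply: measurable_funM => //; apply: measurable_funX; exact: mJ.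
  move=> y _; rewrite -EFinM -EFinD lee_fin indE.
  have -> : [set y : Y | lev y = 0%N] = [set y | lev y == 0%N].
    by apply/seteqP; split=> z /= /eqP.
  rewrite indE (sumE P' (fun i => (lev y < lev (act y (s i)^-1%g))%N))//.
  rewrite [3 * _]mulrA -mulrDl; apply: ler_wpM2r; first exact: sqr_ge0.
  rewrite -natrM -natrD ler_nat.
  exact: steps_up.
(* u^2 <= 3/2 v^2 + 3 (v - u)^2 with v = u(y s_i); moving the integral of v^2
   by s_i turns P i into P' i *)
have step_le i : (J (P i) <= (3 / 2)%:E * J (P' i) + 3%:E * D%:E)%E.
  have mus : measurable_fun setT (fun y : Y => u (act y (s i))).
    exact: measurableT_comp mu (act_measurable (s i)).
  have -> : J (P' i) = sqI (fun y => \1_(P i) y * u (act y (s i))).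
    rewrite /J -(sqint_act (s i)); last exact: mJ.
    apply: sqint_eq => y; rewrite !indicE; congr (_%:R * _); congr nat_of_bool.
    by apply/idP/idP => /set_mem h; apply/mem_set; move: h;
      rewrite /P /P' /= act_mul mulgV act1.
  apply: (@le_trans _ _ ((3 / 2)%:E * sqI (fun y : Y => (\1_(P i) y * u (act y (s i)))%R)
     + 3%:E * sqI (fun y : Y => (u (act y (s i)) - u y)%R))%E).
    apply: sqint_comb => //.
    - exact: mJ.
    - by apply: indicM_measurable.
    - exact: measurable_funB.
    move=> y; rewrite indicE; case: (_ \in _); rewrite /= ?mul1r ?mul0r.
      by have := sqr_ge0 (3 * u y - 2 * u y); have := sqr_ge0 (u (act y (s i)) * 3 - 2 * u y); nra.
    by rewrite expr0n mulr0 add0r mulr_ge0// sqr_ge0.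
  by rewrite leeD2l// lee_pmul2l.
have fineJ A : measurable A -> exists2 x : R, 0 <= x & J A = x%:E.
  move=> mA; exists (fine (J A)); first by rewrite fine_ge0// sqint_ge0.
  by rewrite fineK// Jfin.
have [a1 a10 Ja1] := fineJ _ mpos; have [a0 a00 Ja0] := fineJ _ mzero.
have [x x0 Jx] : exists2 x : 'I_3 -> R, (forall i, 0 <= x i) & forall i, J (P i) = (x i)%:E.
  have /choice[x xP] : forall i, exists x : R, 0 <= x /\ J (P i) = x%:E.
    by move=> i; have [x] := fineJ _ (mP i); exists x.
  by exists x => i; have [] := xP i.
have [x' x'0 Jx'] : exists2 x : 'I_3 -> R, (forall i, 0 <= x i) & forall i, J (P' i) = (x i)%:E.
  have /choice[x' xP] : forall i, exists x : R, 0 <= x /\ J (P' i) = x%:E.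
    by move=> i; have [z] := fineJ _ (mP' i); exists z.
  by exists x' => i; have [] := xP i.
rewrite -/(J [set y | (0 < lev y)%N]) -/(J [set y | lev y = 0%N]) Ja1 Ja0.
move: down up; rewrite Ja1 Ja0 (eq_bigr _ (fun i _ => Jx i)).
rewrite (eq_bigr (fun i => (x' i)%:E) (fun i _ => Jx' i)) !sumEFin.
rewrite -!EFinM -!EFinD !lee_fin => down up.
have : \sum_i x i <= \sum_i (3 / 2 * x' i + 3 * D).
  apply: ler_sum => i _; have := step_le i.
  by rewrite Jx Jx' -!EFinM -EFinD lee_fin.
rewrite big_split /= -mulr_sumr sumr_const card_ord -mulr_natl => h.
by lra.
Qed.

(** With a0 <= 2 D + e/10 from [base_level], the bound a1 <= 9 a0 + 18 D of
    [cusp_level] gives a0 + a1 <= 38 D + e. *)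
Lemma real_gap f D : measurable_fun setT f -> (sqI f < +oo)%E ->
    (\int[m]_y (f y)%:E = 0)%E ->
    (forall s, congr_sub 1 s -> (sqI (fun y => (f (act y s) - f y)%R) <= D%:E)%E) ->
    (forall i, (sqI (fun y => (f (act y (step F i)) - f y)%R) <= D%:E)%E) ->
  (sqI f <= (38 * D)%:E)%E.
Proof.
move=> mf foo f0 fK fs; apply/lee_addgt0Pr => e e0.
have e20 : 0 < e / 20 by rewrite divr_gt0.
have [c base] := base_level mf foo e20 fK.
pose u (y : Y) : R := f y - c.
have mu : measurable_fun setT u by exact: measurable_funB.
have uoo : (sqI u < +oo)%E.
  have fI : (sqI f <= (fine (sqI f))%:E)%E by rewrite fineK// ge0_fin_numE// sqint_ge0.
  have cI : (sqI (cst (- c)%R) <= (c ^+ 2)%:E)%E.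
    rewrite /sqint /= integral_cst// sqrrN.
    by rewrite -[leRHS]mule1; apply: lee_wpmul2l; rewrite ?lee_fin ?sqr_ge0// probability_le1.
  by apply: le_lt_trans (sqint_add mf _ fI cI) (ltry _).
have us i : (sqI (fun y => (u (act y (step F i)) - u y)%R) <= D%:E)%E.
  apply: le_trans (fs i).
  rewrite (@sqint_eq _ _ _ m _ (fun y => f (act y (step F i)) - f y))//.
  by move=> y; rewrite /u; ring.
have cusp := cusp_level mu uoo us.
apply: le_trans (sqint_sub_cst c mf foo f0) _; rewrite -/u.
have mpos : measurable [set y : Y | (0 < lev y)%N] := lev_measurable (fun n => (0 < n)%N).
have mzero : measurable [set y : Y | lev y = 0%N] := lev_measurable (fun n => n = 0%N).
have split_u : (sqI u <= 1%:E * sqI (fun y => (\1_[set y | (0 < lev y)%N] y * u y)%R)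
    + 1%:E * sqI (fun y => (\1_[set y | lev y = 0%N] y * u y)%R))%E.
  apply: sqint_comb => //; [exact: indicM_measurable|exact: indicM_measurable|].
  move=> y; rewrite !indicE; have [y0|y0] := posnP (lev y).
    by rewrite memNset /= ?y0// mem_set//=; lra.
  by rewrite mem_set//= memNset /=; [lra|by move=> y1; rewrite y1 in y0].
apply: le_trans split_u _; rewrite !mul1e.
apply: le_trans (leeD cusp base) _.
apply: le_trans (leeD (leeD (lee_wpmul2l _ base) (lexx _)) (lexx _)) _ => //.
by rewrite -EFinM -!EFinD lee_fin; lra.
Qed.

Definition gap_set : set (PGL2 F) := @congr_sub F 1 `|` range (@step F).

Lemma gap_set_compact : compact gap_set.
Proof.
apply: compactU; first exact: congr_sub_compact.
by apply/finite_compact/finite_image.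
Qed.

Lemma sqnorm2E (f : Y -> R[i]) :
    measurable_fun setT (fun y => complex.Re (f y)) ->
    measurable_fun setT (fun y => complex.Im (f y)) ->
  sqnorm2 m f = (sqI (fun y => complex.Re (f y)) + sqI (fun y => complex.Im (f y)))%E.
Proof.
move=> mRe mIm; rewrite /sqnorm2.
under eq_integral do rewrite EFinD.
rewrite ge0_integralD//; do ?exact: sq_measurable;
  by move=> y _; rewrite lee_fin sqr_ge0.
Qed.

Local Notation koop := (@koopman R _ Y (PGL2 F) (@PGL2_act F)).

(** The real and the imaginary part each satisfy [real_gap] with D = r^2, where
    r is the supremum over the compact set; and 2 * 38 <= 9^2. *)
Lemma spectral_gap_act : spectral_gap m (@PGL2_act F).
Proof.
exists gap_set, (1 / 9); split; [exact: gap_set_compact|by rewrite divr_gt0|].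
move=> f [mRe mIm foo Re0 Im0].
set S := ereal_sup _.
have Sge s : gap_set s ->
    ((norm2 m (fun y => koop s f y - f y)%R)%:E <= S)%E.
  by move=> Qs; apply: ereal_sup_ubound; exists s.
have S0 : (0 <= S)%E.
  apply: le_trans (Sge 1%g _); first by rewrite lee_fin sqrtr_ge0.
  by left; exact: congr_sub1.
case: S Sge S0 => [r|_ _|_]; [|exact: leey|by []].
move=> Sge; rewrite lee_fin => r0.
move: foo; rewrite sqnorm2E// => foo.
have [Refin Imfin] : (sqI (fun y => complex.Re (f y)) < +oo)%E /\
    (sqI (fun y => complex.Im (f y)) < +oo)%E.
  by split; apply: le_lt_trans foo; rewrite ?leeDl ?leeDr// sqint_ge0.
have ReB (y : Y) s : complex.Re (koop s f y - f y) =
    complex.Re (f (act y s)) - complex.Re (f y).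
  by rewrite /koopman; case: (f _) => a b; case: (f _).
have ImB (y : Y) s : complex.Im (koop s f y - f y) =
    complex.Im (f (act y s)) - complex.Im (f y).
  by rewrite /koopman; case: (f _) => a b; case: (f _).
have diff_fin (h : Y -> R) s : measurable_fun setT h -> (sqI h < +oo)%E ->
    measurable_fun setT (fun y : Y => h (act y s) - h y) /\
    (sqI (fun y => (h (act y s) - h y)%R) < +oo)%E.
  move=> mh hoo; have mhs : measurable_fun setT (fun y : Y => h (act y s)).
    exact: measurableT_comp mh (act_measurable s).
  split; first exact: measurable_funB.
  have hI : (sqI h <= (fine (sqI h))%:E)%E by rewrite fineK// ge0_fin_numE// sqint_ge0.
  apply: le_lt_trans (ltry (2 * fine (sqI h) + 2 * fine (sqI h))).
  apply: sqint_add => //; first exact: measurableT_comp.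
    by rewrite sqint_act.
  by apply: le_trans hI; apply: sqint_le => // [|y]; rewrite ?sqrrN//; exact: measurableT_comp.
have bound s : gap_set s ->
    (sqI (fun y => (complex.Re (f (act y s)) - complex.Re (f y))%R) <= (r ^+ 2)%:E)%E /\
    (sqI (fun y => (complex.Im (f (act y s)) - complex.Im (f y))%R) <= (r ^+ 2)%:E)%E.
  move=> Qs; have := Sge s Qs; rewrite lee_fin /norm2.
  have [mR fR] := diff_fin _ s mRe Refin; have [mI fI] := diff_fin _ s mIm Imfin.
  rewrite sqnorm2E; last 2 first.
  - by under eq_fun do rewrite ReB.
  - by under eq_fun do rewrite ImB.
  rewrite (@sqint_eq _ _ _ m _ (fun y : Y => complex.Re (f (act y s)) - complex.Re (f y))); last first.
    by move=> y; rewrite ReB.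
  rewrite (@sqint_eq _ _ _ m (fun y : Y => complex.Im (_ - _)) (fun y : Y => complex.Im (f (act y s)) - complex.Im (f y))); last first.
    by move=> y; rewrite ImB.
  set A := sqint _ _; set B := sqint _ _ => h.
  have A0 : (0 <= A)%E by exact: sqint_ge0.
  have B0 : (0 <= B)%E by exact: sqint_ge0.
  have AB0 : (0 <= A + B)%E := adde_ge0 A0 B0.
  have ABfin : (A + B)%E \is a fin_num.
    by rewrite ge0_fin_numE//; exact: lte_add_pinfty.
  have : (A + B <= (r ^+ 2)%:E)%E.
    rewrite -(fineK ABfin) lee_fin -(@sqr_sqrtr _ (fine _)) ?fine_ge0//.
    by rewrite ler_sqr ?nnegrE// sqrtr_ge0.
  by move=> AB; split; apply: le_trans AB; rewrite ?leeDl ?leeDr.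
have gapRe : (sqI (fun y => complex.Re (f y)) <= (38 * r ^+ 2)%:E)%E.
  apply: real_gap => // [s s1|i]; last by have [] := bound (step F i) (or_intror (imageT _ i)).
  by have [] := bound s (or_introl s1).
have gapIm : (sqI (fun y => complex.Im (f y)) <= (38 * r ^+ 2)%:E)%E.
  apply: real_gap => // [s s1|i]; last by have [] := bound (step F i) (or_intror (imageT _ i)).
  by have [] := bound s (or_introl s1).
rewrite lee_fin -ler_pdivlMl// mulrC mul1r invrK /norm2 sqnorm2E//.
rewrite -(@ger0_norm _ (r * 9)) ?mulr_ge0// -sqrtr_sqr ler_wsqrtr//.
have Rf : sqI (fun y => complex.Re (f y)) \is a fin_num by rewrite ge0_fin_numE ?sqint_ge0.
have If : sqI (fun y => complex.Im (f y)) \is a fin_num by rewrite ge0_fin_numE ?sqint_ge0.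
rewrite fineD//; move: gapRe gapIm; rewrite -{1}(fineK Rf) -{1}(fineK If) !lee_fin.
by have := sqr_ge0 r; nra.
Qed.

End Gap.

(** * The theorem *)

Theorem proposition8p8 (R : realType) (p k q : nat)
    (p_prime : prime p) (k_gt0 : (0 < k)%N) (q_def : q = (p ^ k)%N) :
  [/\ Num.min ((q%:R - 1) / (q%:R + 1))
              (4%:R * q%:R ^+ 2 / ((q%:R + 1) * (q%:R ^+ 2 - 1)))
        <= cheeger (@walk R q) (@walk_measure R q),
      0 < Num.min ((q%:R - 1) / (q%:R + 1))
              (4%:R * q%:R ^+ 2 / ((q%:R + 1) * (q%:R ^+ 2 - 1))) :> R
    & forall (F : finFieldType), #|F| = q ->
      forall m : probability (PGL2_borel F) R,
        measure_preserving m (@PGL2_act F) ->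
        spectral_gap m (@PGL2_act F)].
Proof.
have q2 : 2 <= q%:R :> R.
  rewrite ler_nat q_def; apply: leq_trans (prime_gt1 p_prime) _.
  by rewrite -{1}[p]expn1 leq_pexp2l// prime_gt0.
split.
- by rewrite ge_min cheeger_walk_ge.
- have q21 : 0 < q%:R ^+ 2 - 1 :> R by rewrite subr_gt0 expr_gt1//; lra.
  rewrite lt_min; apply/andP; split; first by apply: divr_gt0; lra.
  apply: divr_gt0; first by apply: mulr_gt0 => //; apply: exprn_gt0; lra.
  by apply: mulr_gt0 => //; lra.
- by move=> F _ m mpres; exact: spectral_gap_act.
Qed.
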